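(* Let $m$ and $k$ be positive integers with $m\ge 2k$, and let $\mathcal{H}(m,k)$ be the bipartite Kneser graph. Then $$2\binom{m}{k}-\binom{2k}{k}\ \le\ \mathrm{pd}(\mathcal{H}(m,k))\ \le\ 2\binom{m}{k}-\max\left\{k+1,\ \frac{\binom{m}{k}}{\binom{m-k}{k}}\right\}.$$
   Context: For positive integers $m,k$ with $m\ge 2k$, write $[m]=\{1,\dots,m\}$. The bipartite Kneser graph $\mathcal{H}(m,k)$ is the finite simple bipartite graph with vertex set the disjoint union $V_1\sqcup V_2$, where $V_1$ is the set of all $k$-element subsets of $[m]$ and $V_2$ is the set of all $(m-k)$-element subsets of $[m]$ (if $m=2k$ the two sides are regarded as disjoint copies); $A\in V_1$ and $B\in V_2$ are joined by an edge if and only if $A\subseteq B$, and there are no other edges. Let $\Bbbk$ be an infinite field. For a finite simple graph $G$, let $R$ be the standard graded polynomial ring over $\Bbbk$ whose variables are in bijection with the vertices of $G$. The edge ideal $I(G)\subset R$ is generated by all products $xy$ of variables corresponding to the endpoints of an edge of $G$. The notation $\mathrm{pd}(G)$ stands for the projective dimension of $R/I(G)$ as an $R$-module, i.e. the largest $i$ such that the graded Betti number $\beta_{i,j}(R/I(G))$ is nonzero for some $j$. *)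

(* Defs.v *)
From HB Require Import structures.
From mathcomp Require Import all_boot all_order all_algebra.
From mathcomp Require Export mpoly.

Set Implicit Arguments.
Unset Strict Implicit.
Unset Printing Implicit Defensive.

Import GRing.Theory.
Local Open Scope ring_scope.

Definition infinite (T : eqType) : Prop := forall s : seq T, exists x, x \notin s.

(** * Finite simple graphs *)

Record sgraph := SGraph {
  vertex :> finType;
  adj : rel vertex;
  adj_sym : ssrbool.symmetric adj;
  adj_irr : irreflexive adj }.

Section BipartiteKneser.
Variables m k : nat.

Definition ksubset (l : nat) := {A : {set 'I_m} | #|A| == l}.

(* The sum type keeps the two sides disjoint, also when m = 2k. *)
Definition kneser_vertex : finType := (ksubset k + ksubset (m - k))%type.

Definition kneser_adj (u v : kneser_vertex) : bool :=
  match u, v with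
  | inl A, inr B => val A \subset val B
  | inr B, inl A => val A \subset val B
  | _, _ => false
  end.

Lemma kneser_adj_sym : ssrbool.symmetric kneser_adj.
Proof. by case=> [A|B] [C|D]. Qed.

Lemma kneser_adj_irr : irreflexive kneser_adj.
Proof. by case. Qed.

Definition bipartite_kneser := SGraph kneser_adj_sym kneser_adj_irr.

End BipartiteKneser.

(** * Edge ideals *)

Section EdgeIdeal.
Variables (K : fieldType) (G : sgraph).

Definition vertex_var (v : G) : {mpoly K[#|G|]} := 'X_(enum_rank v).

Definition edge_ideal (p : {mpoly K[#|G|]}) : Prop :=
  exists c : G -> G -> {mpoly K[#|G|]},
    p = \sum_(x : G) \sum_(y : G | adj x y)
          c x y * (vertex_var x * vertex_var y).

End EdgeIdeal.

(** * Minimal graded free resolutions, Betti numbers, projective dimension *)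

Section Betti.
Variables (K : fieldType) (n : nat).
Local Notation R := {mpoly K[n]}.

(* A minimal graded free resolution of R/I for an ideal I of R:
     ... -> F_2 -> F_1 -> F_0 -> R/I -> 0,  F_i = \bigoplus_r R(- res_deg i r).
   Elements of F_i are row vectors, and maps act by multiplication on the
   right. The augmentation F_0 -> R/I is given by representatives in R of the
   images of the basis vectors. A map is homogeneous of degree 0 when each
   monomial of its (r, c) entry has degree deg(r) - deg(c). *)
Record min_res (I : R -> Prop) := MinRes {
  res_rank : nat -> nat;
  res_deg : forall i, 'I_(res_rank i) -> int;
  res_map : forall i, 'M[R]_(res_rank i.+1, res_rank i);
  res_aug : 'cV[R]_(res_rank 0);
  res_map_homog : forall i r c mon, mon \in msupp (res_map i r c) ->
    res_deg c + (mdeg mon)%:Z = res_deg r;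
  res_aug_homog : forall r mon, mon \in msupp (res_aug r 0) ->
    (mdeg mon)%:Z = res_deg r;
  res_aug_surj : exists u : 'rV[R]_(res_rank 0), I ((u *m res_aug) 0 0 - 1);
  res_exact0 : forall u : 'rV[R]_(res_rank 0),
    I ((u *m res_aug) 0 0) <-> exists w, u = w *m res_map 0;
  res_exact : forall i (u : 'rV[R]_(res_rank i.+1)),
    u *m res_map i = 0 <-> exists w, u = w *m res_map i.+1;
  (* minimality: the entries lie in the ideal generated by the variables *)
  res_minimal : forall i r c, (res_map i r c)@_0%MM = 0 }.

(* [is_betti I i j b] means \beta_{i,j}(R/I) = b. *)
Definition is_betti (I : R -> Prop) (i : nat) (j : int) (b : nat) : Prop :=
  exists F : min_res I, #|[set r : 'I_(res_rank F i) | res_deg r == j]| = b.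

Definition betti_neq0 (I : R -> Prop) (i : nat) (j : int) : Prop :=
  exists2 b, is_betti I i j b & b != 0%N.

(* [is_projdim I p] means pd(R/I) = p. *)
Definition is_projdim (I : R -> Prop) (p : nat) : Prop :=
  (exists j, betti_neq0 I p j) /\
  (forall i j, betti_neq0 I i j -> (i <= p)%N).

Lemma is_projdim_uniq (I : R -> Prop) (p q : nat) :
  is_projdim I p -> is_projdim I q -> p = q.
Proof.
move=> [[j nzp] maxp] [[l nzq] maxq]; apply/eqP.
by rewrite eqn_leq (maxq _ _ nzp) (maxp _ _ nzq).
Qed.

End Betti.

(* [is_pd K G p] means pd(G) = p over the field K. *)
Definition is_pd (K : fieldType) (G : sgraph) (p : nat) : Prop :=
  is_projdim (@edge_ideal K G) p.

(* Main.v *)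
(* The projective dimension of R/I is the largest i with nonzero Koszul homology
   H_i(x; R/I), by dimension shifting along a minimal free resolution.

   Upper bound. Let G be bipartite with sides A and B, and b in B. The sequence
   0 -> R/(I : b) -> R/I -> R/(I, b) -> 0 compares I with edge ideals from which
   b and the neighbours of b, or just b, have been removed. By induction on B,
   H_i(x; R/I) = 0 as soon as i + t > |G|, where t is the least value of
   |X| + #{a in A with no neighbour in X} over the subsets X of B. For the
   Kneser graph t >= k + 1, because k or fewer proper subsets can all be avoided
   by one k-set, and t >= C(m,k) / C(m-k,k), by counting neighbours.

   Lower bound. If S is a maximal independent set and T its complement, the
   product f of the variables in S is not in I but is killed by the variables in
   T modulo I, so H_|T|(x_T; R/I) <> 0 and every resolution reaches degree |T|.
   The k-subsets of a (2k-1)-set, taken on both sides, form such an S of size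
   2 C(2k-1,k) = C(2k,k).

   A minimal graded resolution exists because R is Noetherian, by Dickson's
   lemma. *)
Require Import Defs.
From HB Require Import structures.
From mathcomp Require Import all_boot all_order all_algebra zify.
From Stdlib Require Import Classical ClassicalEpsilon.

Set Implicit Arguments.
Unset Strict Implicit.
Unset Printing Implicit Defensive.

Import Order.TTheory GRing.Theory Num.Theory.
Local Open Scope ring_scope.

(** * Koszul homology *)

Section Submodules.
Variable R : comNzRingType.

Definition submodule r (N : 'rV[R]_r -> Prop) : Prop :=
  N 0 /\ forall a u v, N u -> N v -> N (a *: u + v).

(** A matrix with [k] rows is an element of the tensor product of R^k and R^r; this is the image of
    R^k tensored with [N]. Congruence modulo [N] is expressed by it. *)
Definition rows r (N : 'rV[R]_r -> Prop) k (z : 'M[R]_(k, r)) : Prop :=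
  forall i, N (row i z).

Definition zero_submodule r (u : 'rV[R]_r) : Prop := u = 0.

Lemma rows_zero r k (z : 'M[R]_(k, r)) : rows (@zero_submodule r) z <-> z = 0.
Proof.
split=> [z0|-> i]; last exact: row0.
by apply/row_matrixP=> i; rewrite row0; apply: z0.
Qed.

Section Closure.
Variables (r : nat) (N : 'rV[R]_r -> Prop).
Hypothesis subN : submodule N.

Lemma rows0 k : rows N (0 : 'M_(k, r)).
Proof. by move=> i; rewrite row0; case: subN. Qed.

Lemma submoduleD u v : N u -> N v -> N (u + v).
Proof. by move=> Nu Nv; rewrite -[u]scale1r; apply: subN.2. Qed.

Lemma submoduleZ a u : N u -> N (a *: u).
Proof. by move=> Nu; rewrite -[a *: u]addr0; apply: subN.2 => //; case: subN. Qed.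

Lemma submodule_sum (I : Type) (s : seq I) (F : I -> 'rV[R]_r) :
  (forall i, N (F i)) -> N (\sum_(i <- s) F i).
Proof.
move=> NF; apply: (big_ind N) => //; [exact: subN.1 | exact: submoduleD].
Qed.

Lemma rowsD k (y z : 'M_(k, r)) : rows N y -> rows N z -> rows N (y + z).
Proof. by move=> Ny Nz i; rewrite linearD; apply: submoduleD; [apply: Ny | apply: Nz]. Qed.

Lemma rowsZ k a (z : 'M_(k, r)) : rows N z -> rows N (a *: z).
Proof. by move=> Nz i; rewrite linearZ; apply/submoduleZ/Nz. Qed.

Lemma rowsN k (z : 'M_(k, r)) : rows N z -> rows N (- z).
Proof. by move=> Nz; rewrite -scaleN1r; apply: rowsZ. Qed.

Lemma rowsB k (y z : 'M_(k, r)) : rows N y -> rows N z -> rows N (y - z).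
Proof. by move=> Ny Nz; apply: rowsD => //; apply: rowsN. Qed.

Lemma rows_mull l k (A : 'M_(l, k)) (z : 'M_(k, r)) :
  rows N z -> rows N (A *m z).
Proof.
move=> Nz i; rewrite row_mul mulmx_sum_row.
by apply: submodule_sum => j; apply/submoduleZ/Nz.
Qed.

Lemma rows_col_mx k l (y : 'M_(k, r)) (z : 'M_(l, r)) :
  rows N y -> rows N z -> rows N (col_mx y z).
Proof.
move=> Ny Nz i; case: (split_ordP i) => j ->.
  by rewrite rowKu; apply: Ny.
by rewrite rowKd; apply: Nz.
Qed.

End Closure.

Lemma rows_lift r r' (N : 'rV[R]_r -> Prop) (phi : 'M[R]_(r', r)) k
    (z : 'M_(k, r)) :
  (forall u, N u -> exists w, u = w *m phi) -> rows N z ->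
  exists y, z = y *m phi.
Proof.
move=> Nphi Nz; have zphi i : exists w, row i z == w *m phi.
  by have [w ->] := Nphi _ (Nz i); exists w.
exists (\matrix_i xchoose (zphi i)); apply/row_matrixP=> i.
by rewrite row_mul rowK; apply/eqP; exact: (xchooseP (zphi i)).
Qed.

End Submodules.

(** * The Koszul complex as a matrix *)

Section Koszul.
Variables (K : fieldType) (n : nat).
Local Notation R := {mpoly K[n]}.

Fixpoint ksize (s : seq 'I_n) : nat :=
  if s is _ :: s' then (ksize s' + ksize s')%N else 1%N.

(* The Koszul complex of the variables in s is the exterior algebra with basis
   indexed by 'I_(ksize s), seen as the mapping cone of 'X_x on the complex of
   the tail; [koszul s] is its total differential, acting on the left, and
   [kgrade s i] is the projection onto the component of degree i. A matrix
   with r columns is thus an element of the Koszul complex of R^r. *)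
Fixpoint koszul (s : seq 'I_n) : 'M[R]_(ksize s) :=
  match s with
  | [::] => 0
  | x :: s' => block_mx (koszul s') ('X_x)%:M 0 (- koszul s')
  end.

Fixpoint kgrade (s : seq 'I_n) (i : int) : 'M[R]_(ksize s) :=
  match s with
  | [::] => ((i == 0)%:R)%:M
  | x :: s' => block_mx (kgrade s' i) 0 0 (kgrade s' (i - 1))
  end.

Lemma koszulK s : koszul s *m koszul s = 0.
Proof.
elim: s => [|x s IH] /=; first by rewrite mul0mx.
rewrite mulmx_block !mul0mx !mulmx0 !mulmxN !mulNmx opprK IH !addr0.
by rewrite mul_mx_scalar mul_scalar_mx subrr block_mx0.
Qed.

Lemma kgradeK s i : kgrade s i *m kgrade s i = kgrade s i.
Proof.
elim: s i => [|x s IH] i /=.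
  by rewrite -scalar_mxM -natrM mulnb andbb.
by rewrite mulmx_block !mul0mx !mulmx0 !addr0 !add0r !IH.
Qed.

Lemma koszul_kgrade s i : koszul s *m kgrade s i = kgrade s (i - 1) *m koszul s.
Proof.
elim: s i => [|x s IH] i /=; first by rewrite mul0mx mulmx0.
rewrite !mulmx_block !mul0mx !mulmx0 !addr0 !add0r !mulNmx !mulmxN !IH.
by rewrite mul_mx_scalar mul_scalar_mx.
Qed.

Lemma kgrade_lt0 s i : i < 0 -> kgrade s i = 0.
Proof.
elim: s i => [|x s IH] i i_lt0 /=; first by rewrite lt_eqF ?raddf0.
by rewrite !IH ?block_mx0 // ltrBlDr ltr_wpDr.
Qed.

Lemma kgrade_gt_size s i : (size s)%:Z < i -> kgrade s i = 0.
Proof.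
elim: s i => [|x s IH] i /=; first by move=> i_gt0; rewrite gt_eqF ?raddf0.
rewrite intS => lt_i; rewrite !IH ?block_mx0 ?ltrBrDl //.
by apply: le_lt_trans lt_i; rewrite lerDr.
Qed.

Lemma koszul_kgrade0 s r (z : 'M_(ksize s, r)) :
  kgrade s 0 *m z = z -> koszul s *m z = 0.
Proof. by move=> <-; rewrite mulmxA koszul_kgrade kgrade_lt0 ?mul0mx. Qed.

Lemma kgradeP s i r (z : 'M_(ksize s, r)) :
  kgrade s i *m (kgrade s i *m z) = kgrade s i *m z.
Proof. by rewrite mulmxA kgradeK. Qed.

Lemma koszulKx s r (z : 'M_(ksize s, r)) : koszul s *m (koszul s *m z) = 0.
Proof. by rewrite mulmxA koszulK mul0mx. Qed.

(* [acyclic s i N]: the i-th Koszul homology of R^r / N vanishes. *)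
Definition acyclic s (i : int) r (N : 'rV[R]_r -> Prop) : Prop :=
  forall z : 'M_(ksize s, r), kgrade s i *m z = z -> rows N (koszul s *m z) ->
  exists w, rows N (z - koszul s *m w).

(** The primitive can be projected to degree [i + 1]: the projections commute with the differential
    up to a shift, and they preserve [N]. *)
Lemma acyclic_graded s i r (N : 'rV[R]_r -> Prop) (z : 'M_(ksize s, r)) :
  submodule N -> acyclic s i N ->
  kgrade s i *m z = z -> rows N (koszul s *m z) ->
  exists2 w, rows N (z - koszul s *m w) & kgrade s (i + 1) *m w = w.
Proof.
move=> subN acyN zi Nz; have [w Nw] := acyN z zi Nz.
exists (kgrade s (i + 1) *m w); last exact: kgradeP.
rewrite mulmxA koszul_kgrade addrK -mulmxA -[in X in X - _]zi -mulmxBr.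
exact: rows_mull.
Qed.

Lemma acyclic_ext s i r (N N' : 'rV[R]_r -> Prop) :
  (forall u, N u <-> N' u) -> acyclic s i N -> acyclic s i N'.
Proof.
move=> eqN acyN z zi Nz; have [|w Nw] := acyN z zi.
  by move=> j; apply/eqN.
by exists w => j; apply/eqN.
Qed.

End Koszul.

(** * Monomial ideals *)

Section MonomialIdeals.
Variables (K : fieldType) (n : nat).
Local Notation R := {mpoly K[n]}.

Definition upclosed (P : pred 'X_{1..n}) : Prop :=
  forall m m', P m -> P (m + m')%MM.

(** Membership is tested monomial by monomial. For [upclosed P] this is an ideal, and its colon by a
    variable is a shift of [P]. *)
Definition monomial_ideal (P : pred 'X_{1..n}) (f : R) : bool := all P (msupp f).

(** The exponents of the monomials in the ideal (s) generated by the variables in [s]. *)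
Definition meets (s : seq 'I_n) (m : 'X_{1..n}) : bool := has (fun x => m x != 0%N) s.

Lemma meets_upclosed s : upclosed (meets s).
Proof.
move=> m m' /hasP[x xs mx]; apply/hasP; exists x => //.
by rewrite mnmDE addn_eq0 negb_and mx.
Qed.

Section Ideal.
Variable P : pred 'X_{1..n}.

Lemma monomial_idealP (f : R) :
  reflect (forall m, f@_m != 0 -> P m) (monomial_ideal P f).
Proof.
apply: (iffP allP) => Pf m; first by rewrite -mcoeff_msupp; apply: Pf.
by rewrite mcoeff_msupp; apply: Pf.
Qed.

Lemma monomial_ideal0 : monomial_ideal P 0.
Proof. by rewrite /monomial_ideal msupp0. Qed.

Lemma monomial_idealD f g :
  monomial_ideal P f -> monomial_ideal P g -> monomial_ideal P (f + g).
Proof.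
move=> /allP Pf /allP Pg; apply/allP=> m /msuppD_le.
by rewrite mem_cat => /orP[/Pf|/Pg].
Qed.

Lemma monomial_ideal_sum (I : Type) (s : seq I) (Q : pred I) (F : I -> R) :
  (forall i, Q i -> monomial_ideal P (F i)) ->
  monomial_ideal P (\sum_(i <- s | Q i) F i).
Proof.
move=> PF; apply: (big_ind (monomial_ideal P)) => //.
  exact: monomial_ideal0.
exact: monomial_idealD.
Qed.

Lemma monomial_idealZX c m : P m -> monomial_ideal P (c *: 'X_[m]).
Proof. by move=> Pm; apply/allP=> m' /msuppZ_le; rewrite msuppX inE => /eqP->. Qed.

Hypothesis upP : upclosed P.

Lemma monomial_idealM f g : monomial_ideal P f -> monomial_ideal P (g * f).
Proof.
move=> /allP Pf; apply/allP=> m /msuppM_le /allpairsP[[m1 m2] /= [_ /Pf Pm ->]].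
by rewrite addmC; apply: upP.
Qed.

Definition ideal_rows r (u : 'rV[R]_r) : Prop := forall j, monomial_ideal P (u 0 j).

Lemma ideal_rows_submodule r : submodule (@ideal_rows r).
Proof.
split=> [j|a u v Pu Pv j]; first by rewrite mxE monomial_ideal0.
by rewrite !mxE monomial_idealD ?monomial_idealM.
Qed.

Lemma ideal_rowsP r k (z : 'M_(k, r)) :
  rows (@ideal_rows r) z <-> forall i j, monomial_ideal P (z i j).
Proof.
split=> Pz i j; last by rewrite mxE.
by have := Pz i j; rewrite mxE.
Qed.

End Ideal.

Lemma monomial_ideal_mulX P x (f : R) :
  monomial_ideal P ('X_x * f) = monomial_ideal (fun m => P (U_(x) + m)%MM) f.
Proof.
rewrite mulrC /monomial_ideal; rewrite (perm_all _ (msuppMX _ _)).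
by rewrite all_map; apply: eq_all.
Qed.

Lemma monomial_ideal_split x (f : R) : exists f0 f1, f = f0 + 'X_x * f1 /\
  monomial_ideal (fun m => (m \in msupp f) && (m x == 0%N)) f0.
Proof.
exists (\sum_(m <- msupp f | m x == 0%N) f@_m *: 'X_[m]).
exists (\sum_(m <- msupp f | m x != 0%N) f@_m *: 'X_[(m - U_(x))%MM]); split.
  rewrite {1}[f]mpolyE (bigID (fun m : 'X_{1..n} => m x == 0%N)) /=.
  congr (_ + _); rewrite mulr_sumr; apply: eq_bigr => m mx.
  by rewrite -scalerAr -mpolyXD addmC submK // lep1mP.
rewrite big_seq_cond; apply: monomial_ideal_sum => m /andP[fm mx].
by apply: monomial_idealZX; rewrite fm mx.
Qed.

Lemma ideal_rows_split (P Q : pred 'X_{1..n}) x r k (z : 'M[R]_(k, r)) :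
  (forall m, P m -> m x = 0%N -> Q m) -> rows (@ideal_rows P r) z ->
  exists z0 z1, z = z0 + 'X_x *: z1 /\ rows (@ideal_rows Q r) z0.
Proof.
move=> PQ /ideal_rowsP Pz.
pose ex i j := exists f : R * R, (z i j == f.1 + 'X_x * f.2) && monomial_ideal Q f.1.
have exz i j : ex i j.
  have [f0 [f1 [Df /allP Pf0]]] := monomial_ideal_split x (z i j).
  exists (f0, f1); rewrite -Df eqxx; apply/allP=> m /Pf0/andP[zm /eqP mx].
  by apply: PQ mx; apply: (allP (Pz i j)).
exists (\matrix_(i, j) (xchoose (exz i j)).1), (\matrix_(i, j) (xchoose (exz i j)).2).
split; last first.
  by apply/ideal_rowsP=> i j; rewrite mxE; case/andP: (xchooseP (exz i j)).
apply/matrixP=> i j; rewrite !mxE; apply/eqP.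
by case/andP: (xchooseP (exz i j)).
Qed.

End MonomialIdeals.

(** * Vanishing of Koszul homology modulo monomial ideals *)

Section KoszulHomology.
Variables (K : fieldType) (n : nat).
Local Notation R := {mpoly K[n]}.

Lemma koszul_cons x s r (a b : 'M[R]_(ksize s, r)) :
  koszul K (x :: s) *m (col_mx a b : 'M_(ksize (x :: s), r)) =
  col_mx (koszul K s *m a + 'X_x *: b) (- (koszul K s *m b)).
Proof. by rewrite /= mul_block_col mul0mx add0r mul_scalar_mx mulNmx. Qed.

Lemma kgrade_cons x s i r (a b : 'M[R]_(ksize s, r)) :
  kgrade K (x :: s) i *m (col_mx a b : 'M_(ksize (x :: s), r)) =
  col_mx (kgrade K s i *m a) (kgrade K s (i - 1) *m b).
Proof. by rewrite /= mul_block_col !mul0mx add0r addr0. Qed.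

Lemma kgrade_sub x s i r (a b : 'M[R]_(ksize s, r)) :
  kgrade K (x :: s) i *m (col_mx a b : 'M_(ksize (x :: s), r)) = col_mx a b ->
  kgrade K s i *m a = a /\ kgrade K s (i - 1) *m b = b.
Proof. by rewrite kgrade_cons => /eq_col_mx. Qed.

(** The entries of the differential are zero or, up to sign, variables in [s]. *)
Lemma koszul_rows s r (N : 'rV[R]_r -> Prop) (z : 'M_(ksize s, r)) :
  submodule N -> (forall x, x \in s -> rows N ('X_x *: z)) ->
  rows N (koszul K s *m z).
Proof.
move=> subN; elim: s z => [|x s IH] z Nz; first by rewrite mul0mx; apply: rows0.
rewrite -[z]vsubmxK in Nz *; move: (usubmx z) (dsubmx z) Nz => a b Nz.
have Nab y : y \in x :: s -> rows N ('X_y *: a) /\ rows N ('X_y *: b).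
  move/Nz; rewrite scale_col_mx => Ny; split=> i.
    by have := Ny (lshift _ i); rewrite rowKu.
  by have := Ny (rshift _ i); rewrite rowKd.
rewrite koszul_cons; apply: rows_col_mx; last first.
  apply: rowsN => //; apply: IH => y ys; apply: (Nab y _).2.
  by rewrite inE ys orbT.
apply: rowsD => //; last by apply: (Nab x _).2; rewrite mem_head.
by apply: IH => y ys; apply: (Nab y _).1; rewrite inE ys orbT.
Qed.

Lemma koszul_boundary_meets s r (w : 'M[R]_(ksize s, r)) :
  rows (@ideal_rows K n (meets s) r) (koszul K s *m w).
Proof.
apply: koszul_rows => [|x xs]; first exact/ideal_rows_submodule/meets_upclosed.
apply/ideal_rowsP=> i j; rewrite mxE monomial_ideal_mulX.
by apply/allP=> m _; apply/hasP; exists x; rewrite ?mnmDE ?mnm1E ?eqxx.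
Qed.

Lemma koszul_graded s i r (w : 'M[R]_(ksize s, r)) :
  kgrade K s (i + 1) *m w = w -> kgrade K s i *m (koszul K s *m w) = koszul K s *m w.
Proof. by move=> wi; rewrite mulmxA -[i](addrK 1) -koszul_kgrade -mulmxA wi. Qed.

Lemma koszul_boundary_lift s i r (b w : 'M[R]_(ksize s, r)) :
  kgrade K s i *m b = b -> b = koszul K s *m w ->
  b = koszul K s *m (kgrade K s (i + 1) *m w).
Proof. by move=> bi bw; rewrite mulmxA koszul_kgrade addrK -mulmxA -bw bi. Qed.

(** In degree 0 the homology is R^r modulo (s). The lower block of [z] has degree -1 and vanishes;
    the upper one is [a1 + 'X_x *: c], where [a1] is a boundary by induction and the rest is the
    boundary of [c] placed in the lower block. *)
Lemma koszul_boundary0 s r (z : 'M[R]_(ksize s, r)) :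
  kgrade K s 0 *m z = z -> rows (@ideal_rows K n (meets s) r) z ->
  exists w, z = koszul K s *m w.
Proof.
elim: s z => [|x s IH] z z0 mz.
  exists 0; rewrite mulmx0; apply/matrixP=> i j; rewrite mxE.
  apply/msuppnil0; case Dm: msupp => [//|m l].
  by have /ideal_rowsP/(_ i j) := mz; rewrite /monomial_ideal Dm.
rewrite -[z]vsubmxK in z0 mz *; move: (usubmx z) (dsubmx z) z0 mz => a b.
move=> /kgrade_sub[a0]; rewrite kgrade_lt0 // mul0mx => <- {b} mz.
have ma : rows (@ideal_rows K n (meets (x :: s)) r) a.
  by move=> i; have := mz (lshift _ i); rewrite rowKu.
have [a1 [c [Da ma1]]]: exists a1 c, a = a1 + 'X_x *: c /\
    rows (@ideal_rows K n (meets s) r) a1.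
  by apply: ideal_rows_split ma => m; rewrite /meets /= => /orP[/negP|//] mx /eqP.
have [|a2 Da2] := IH (kgrade K s 0 *m a1) (kgradeP _ _).
  by apply: rows_mull ma1; apply/ideal_rows_submodule/meets_upclosed.
exists (col_mx a2 (kgrade K s 0 *m c)); rewrite koszul_cons.
rewrite (koszul_kgrade0 (kgradeP _ _)) oppr0 -Da2 scalemxAr -mulmxDr.
by rewrite -Da a0.
Qed.

(** Distinct variables form a regular sequence. In the mapping cone, the lower block [b] of a cycle
    is a boundary of some [c], and then [a + 'X_x *: c] is a cycle for the tail. *)
Lemma koszul_acyclic s (i : int) r : uniq s -> 0 < i ->
  acyclic s i (@zero_submodule R r).
Proof.
elim: s i => [|x s IH] i; move=> Us i_gt0 z zi /rows_zero z0.
  exists 0; rewrite mulmx0 subr0; apply/rows_zero.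
  by rewrite -zi /= gt_eqF // raddf0 mul0mx.
case/andP: Us => xs Us; rewrite -[z]vsubmxK in zi z0 *.
move: (usubmx z) (dsubmx z) zi z0 => a b /kgrade_sub[ai bi].
rewrite koszul_cons -[0]vsubmxK !linear0 => /eq_col_mx[Dab /eqP].
rewrite oppr_eq0 => /eqP Db.
have [b' Db'] : exists b', b = koszul K s *m b'.
  case: (ltrP 0 (i - 1)) => [i1_gt0|i1_le0].
    have [|b' /rows_zero/eqP] := IH _ Us i1_gt0 b bi; first exact/rows_zero.
    by rewrite subr_eq0 => /eqP; exists b'.
  (* For [i = 1] the induction hypothesis does not reach [b]. But ['X_x *: b] is a boundary, hence
     has entries in (s), and ['X_x] cancels because [x] is not in [s]. *)
  have i1 : i - 1 = 0.
    by apply/eqP; rewrite eq_le i1_le0 subr_ge0 -gtz0_ge1.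
  apply: koszul_boundary0; first by rewrite -[in LHS]i1.
  apply/ideal_rowsP=> j l; move/eqP: Dab; rewrite addr_eq0 => /eqP Dab.
  have /ideal_rowsP/(_ j l) := koszul_boundary_meets (- a).
  rewrite mulmxN Dab opprK mxE monomial_ideal_mulX.
  apply: sub_all => m /hasP[y ys my]; apply/hasP; exists y => //.
  move: my; rewrite mnmDE mnm1E; by case: (x =P y) => [xy|//]; rewrite xy ys in xs.
have {}Db' := koszul_boundary_lift bi Db'; rewrite subrK in Db'.
set c := _ *m b' in Db'.
have [||a' /rows_zero/eqP] := IH _ Us i_gt0 (a + 'X_x *: c).
- by rewrite mulmxDr ai -scalemxAr kgradeP.
- by apply/rows_zero; rewrite mulmxDr -scalemxAr -Db'.
rewrite subr_eq0 => /eqP Da'.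
exists (col_mx a' (- c)); apply/rows_zero/eqP; rewrite subr_eq0 koszul_cons.
by rewrite -Da' mulmxN opprK -Db' scalerN addrK.
Qed.

Local Notation aideal s i P := (acyclic s i (@ideal_rows K n P 1)).

(* Exactness of the Koszul homology of 0 -> R/(I : x) -> R/I -> R/(I, x) -> 0
   in the middle. *)
Lemma acyclic_colon s i P x : upclosed P ->
  aideal s i (fun m => P (U_(x) + m)%MM) -> aideal s i (fun m => P m || (m x != 0%N)) ->
  aideal s i P.
Proof.
move=> upP acyC acyS z zi Pz.
have subP := @ideal_rows_submodule K n P upP 1.
have upC : upclosed (fun m => P (U_(x) + m)%MM).
  by move=> m m' Pm; rewrite addmA; apply: upP.
have subC := @ideal_rows_submodule K n _ upC 1.
have upS : upclosed (fun m => P m || (m x != 0%N)).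
  move=> m m' /orP[/upP->//|mx]; apply/orP; right.
  by rewrite mnmDE addn_eq0 negb_and mx.
have CP (y : 'M_(ksize s, 1)) : rows (@ideal_rows K n (fun m => P (U_(x) + m)%MM) 1) y <->
    rows (@ideal_rows K n P 1) ('X_x *: y).
  by rewrite !ideal_rowsP; split=> Py j l; have := Py j l; rewrite !mxE monomial_ideal_mulX.
have [|w Sw wi] := acyclic_graded (@ideal_rows_submodule K n _ upS 1) acyS zi.
  by move=> j l; apply: sub_all (Pz j l) => m ->.
have [|z0 [z1 [Dz Pz0]]] := @ideal_rows_split _ _ _ P x _ _ _ _ Sw.
  by move=> m /orP[//|mx mx0]; rewrite mx0 in mx.
have ui : kgrade K s i *m (z - koszul K s *m w) = z - koszul K s *m w.
  by rewrite mulmxBr zi koszul_graded.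
pose v := kgrade K s i *m z1; pose p := kgrade K s i *m z0.
have Du : z - koszul K s *m w = p + 'X_x *: v.
  by rewrite -ui Dz mulmxDr -scalemxAr.
have Pp : rows (@ideal_rows K n P 1) p by apply: rows_mull.
(* [v] is a cycle modulo the colon: the differential of ['X_x *: v] is that of [z] minus that of
   [p], both in the ideal. *)
have [||w' /CP Nw'] := acyC v; first exact: kgradeP.
  apply/CP; rewrite scalemxAr -[X in _ *m X](addKr p) -Du mulmxDr mulmxN.
  rewrite mulmxBr koszulKx subr0 addrC; apply: rowsB => //.
  exact: rows_mull.
exists (w + 'X_x *: w'); rewrite mulmxDr opprD addrA Du -scalemxAr -addrA -scalerBr.
exact: rowsD.
Qed.

(** Induction along 0 -> R/(Y) -> R/(Y) -> R/(y, Y) -> 0, whose first map is multiplication by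
    ['X_y]. Vanishing for R/(Y) in degrees [i] and [i - 1] gives vanishing for R/(y, Y) in degree
    [i]. *)
Lemma acyclic_meets s Y i : uniq s -> uniq Y -> (size Y)%:Z < i ->
  aideal s i (meets Y).
Proof.
move=> Us; elim: Y i => [|y Y IH] i /= UY lt_i.
  apply: (acyclic_ext _ (@koszul_acyclic s i 1 Us lt_i)) => u; split=> [-> j|m0].
    by rewrite mxE monomial_ideal0.
  apply/rowP=> j; rewrite mxE; apply/msuppnil0; case Dm: msupp => [//|m l].
  by have := m0 j; rewrite /monomial_ideal Dm.
move=> z zi Yz; case/andP: UY => yY UY.
have subY := @ideal_rows_submodule K n _ (@meets_upclosed n Y) 1.
have subyY := @ideal_rows_submodule K n _ (@meets_upclosed n (y :: Y)) 1.
have YyY k (u : 'M_(k, 1)) : rows (@ideal_rows K n (meets Y) 1) u ->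
    rows (@ideal_rows K n (meets (y :: Y)) 1) u.
  by move=> Yu j l; apply: sub_all (Yu j l) => m; rewrite /meets /= => ->; rewrite orbT.
have [|z0 [z1 [Dz Yz0]]] := @ideal_rows_split _ _ _ (meets Y) y _ _ _ _ Yz.
  by move=> m /orP[mx mx0|//]; rewrite mx0 in mx.
have Dzi : kgrade K s (i - 1) *m (koszul K s *m z) = koszul K s *m z.
  by rewrite mulmxA -koszul_kgrade -mulmxA zi.
pose v := kgrade K s (i - 1) *m z1; pose p := kgrade K s (i - 1) *m z0.
have Yp : rows (@ideal_rows K n (meets Y) 1) p by apply: rows_mull.
have {}Dz : koszul K s *m z = p + 'X_y *: v.
  by rewrite -Dzi Dz mulmxDr -scalemxAr.
have lt_i1 : (size Y)%:Z < i - 1 by rewrite ltrBrDl -intS.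
(* [v] represents the image of [z] under the connecting map. It is a cycle modulo (Y) because ['X_y]
   cancels there, [y] not being in [Y]; its primitive [w] corrects [z] to a cycle modulo (Y). *)
have [|w Yw wi] := acyclic_graded subY (IH _ UY lt_i1) (kgradeP _ z1).
  have : rows (@ideal_rows K n (meets Y) 1) ('X_y *: (koszul K s *m v)).
    rewrite scalemxAr -[X in _ *m X](addKr p) -Dz mulmxDr mulmxN koszulKx addr0.
    by apply: rowsN => //; apply: rows_mull.
  rewrite !ideal_rowsP => Yv j l; have := Yv j l.
  rewrite mxE monomial_ideal_mulX; apply: sub_all => m /hasP[x xY mx].
  apply/hasP; exists x => //; move: mx; rewrite mnmDE mnm1E.
  by case: (y =P x) => [yx|//]; rewrite yx xY in yY.
rewrite subrK -/v in wi Yw.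
have lt_i0 : (size Y)%:Z < i by apply: lt_trans lt_i1 _; rewrite gtrBl.
have [||w' Yw'] := IH i UY lt_i0 (z - 'X_y *: w).
- by rewrite mulmxBr zi -scalemxAr wi.
- rewrite mulmxBr Dz -scalemxAr -addrA -scalerBr; apply: rowsD => //.
  exact: rowsZ.
exists w'; rewrite -[z](subrK ('X_y *: w)) addrAC; apply: rowsD => //.
  exact: YyY.
apply/ideal_rowsP=> j l; rewrite mxE monomial_ideal_mulX; apply/allP=> m _.
by rewrite /meets /= mnmDE mnm1E eqxx.
Qed.

End KoszulHomology.

(** * The depth of bipartite edge ideals *)

Section BipartiteDepth.
Variables (K : fieldType) (G : finType) (e : rel G).
Local Notation n := #|G|.

(** The monomials of the ideal generated by the edges between [A] and [B] and by the variables in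
    [Y], which collects vertices moved out of [A] and [B] during the induction. *)
Definition bip_monomial (A B Y : {set G}) (m : 'X_{1..n}) : bool :=
  [exists y in Y, m (enum_rank y) != 0%N] ||
  [exists a in A, exists b in B,
     [&& e a b, m (enum_rank a) != 0%N & m (enum_rank b) != 0%N]].

Lemma bip_monomialP (A B Y : {set G}) (m : 'X_{1..n}) : reflect
  ((exists2 y, y \in Y & m (enum_rank y) != 0%N) \/
   (exists a b, [/\ a \in A, b \in B, e a b, m (enum_rank a) != 0%N
                  & m (enum_rank b) != 0%N]))
  (bip_monomial A B Y m).
Proof.
apply: (iffP orP) => -[].
- by case/existsP=> y /andP[Yy my]; left; exists y.
- case/existsP=> a /andP[Aa /existsP[b /and4P[Bb ab ma mb]]].
  by right; exists a, b.
- by case=> y Yy my; left; apply/existsP; exists y; rewrite Yy.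
case=> a [b [Aa Bb ab ma mb]]; right; apply/existsP; exists a; rewrite Aa.
by apply/existsP; exists b; rewrite Bb ab ma.
Qed.

Lemma bip_monomial_upclosed (A B Y : {set G}) : upclosed (bip_monomial A B Y).
Proof.
have addne (m m' : 'X_{1..n}) (i : 'I_n) : m i != 0%N -> (m + m')%MM i != 0%N.
  by move=> mi; rewrite mnmDE addn_eq0 negb_and mi.
move=> m m' /bip_monomialP[[y Yy my]|[a [b [Aa Bb ab ma mb]]]].
  by apply/bip_monomialP; left; exists y => //; apply: addne.
by apply/bip_monomialP; right; exists a, b; split=> //; apply: addne.
Qed.

Definition undominated (A X : {set G}) : {set G} :=
  [set a in A | [forall b in X, ~~ e a b]].

Local Notation aideal s i P := (acyclic s i (@ideal_rows K n P 1)).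

Lemma acyclic_eq_ideal s i (P Q : pred 'X_{1..n}) : P =1 Q -> aideal s i P -> aideal s i Q.
Proof.
move=> eqPQ; apply: acyclic_ext => u.
by split=> Pu j; have := Pu j; rewrite /monomial_ideal (eq_all eqPQ).
Qed.

(** Induction on the size of [B], removing [b] by [acyclic_colon]. When [B] is empty, [X = set0]
    gives t <= |A|, hence |Y| < i, and [acyclic_meets] applies. *)
Lemma bip_acyclic s (A B Y : {set G}) (t : nat) (i : int) : uniq s ->
  [disjoint B & A] -> [disjoint B & Y] ->
  (forall X : {set G}, X \subset B -> (t <= #|X| + #|undominated A X|)%N) ->
  (#|A| + #|B| + #|Y|)%:Z < i + t%:Z ->
  aideal s i (bip_monomial A B Y).
Proof.
move=> Us; move Dc: #|B| => c; elim: c A B Y t Dc => [|c IH] A B Y t Dc dBA dBY tX lt_i.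
  have {Dc}B0 : B = set0 by apply/eqP; rewrite -cards_eq0 Dc.
  have le_tA : (t <= #|A|)%N.
    have := tX set0 (sub0set _); rewrite cards0 add0n => le_t.
    by apply: leq_trans le_t _; apply/subset_leq_card/subsetP=> a; rewrite inE => /andP[].
  have : aideal s i (meets [seq enum_rank y | y <- enum Y]).
    apply: acyclic_meets => //; first by rewrite map_inj_uniq ?enum_uniq //; apply: enum_rank_inj.
    by rewrite size_map -cardE; lia.
  apply: acyclic_eq_ideal => m; apply/hasP/bip_monomialP => [[_ /mapP[y Yy ->] my]|].
    by left; exists y; rewrite // -mem_enum.
  case=> [[y Yy my]|[a [b []]]]; last by rewrite B0 inE.
  by exists (enum_rank y) => //; apply: map_f; rewrite mem_enum.
have [b Bb] : exists b, b \in B by apply/card_gt0P; rewrite Dc.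
have bA : b \notin A by rewrite (disjointFr dBA).
have bY : b \notin Y by rewrite (disjointFr dBY).
have cB' : #|B :\ b| = c by move: Dc; rewrite (cardsD1 b) Bb => -[].
have sB' : B :\ b \subset B by apply: subD1set.
pose N := [set a | e a b].
apply: (@acyclic_colon _ _ _ _ _ (enum_rank b)); first exact: bip_monomial_upclosed.
  (* Colon by [b]: its neighbours become generators and [b] disappears, so the vertex count drops by
     one. So may [t], since a set [X] for the smaller graph corresponds to [b |: X], with the same
     undominated vertices. *)
  apply: (acyclic_eq_ideal _ (IH (A :\: N) (B :\ b) (Y :|: (A :&: N)) t.-1 cB' _ _ _ _)).
  - have Ub v (m : 'X_{1..n}) : (U_(enum_rank b) + m)%MM (enum_rank v) != 0%N =
        (v == b) || (m (enum_rank v) != 0%N).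
      rewrite mnmDE mnm1E (inj_eq enum_rank_inj) [v == b]eq_sym.
      by case: (b == v).
    move=> m; apply/bip_monomialP/bip_monomialP.
      case=> [[y]|[a [d []]]].
        rewrite !inE => /orP[Yy|/andP[Ay yb]] my.
          by left; exists y => //; rewrite Ub my orbT.
        by right; exists y, b; rewrite !Ub my orbT eqxx.
      rewrite !inE => /andP[_ Aa] /andP[_ Bd] ad ma md.
      by right; exists a, d; rewrite !Ub ma md !orbT.
    case=> [[y Yy]|[a [d []]]].
      rewrite Ub; case/orP=> [/eqP yb|my]; first by rewrite yb (negPf bY) in Yy.
      by left; exists y; rewrite // inE Yy.
    move=> Aa Bd ad; rewrite !Ub; case/orP=> [/eqP ab|ma]; first by rewrite ab (negPf bA) in Aa.
    have [ab _|ab] := boolP (e a b).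
      by left; exists a; rewrite // !inE Aa ab orbT.
    case/orP=> [/eqP db|md]; first by rewrite db (negPf ab) in ad.
    right; exists a, d; split=> //; rewrite !inE ?ab // Bd andbT.
    by apply: contraNneq ab => <-.
  - apply: (disjointWr (subsetDl _ _)); exact: disjointWl dBA.
  - rewrite disjoints_subset; apply/subsetP=> x /(subsetP sB') Bx.
    by rewrite !inE (disjointFr dBY Bx) (disjointFr dBA Bx).
  - move=> X sXB; have bX : b \notin X.
      by apply/negP => /(subsetP sXB); rewrite !inE eqxx.
    have := tX (b |: X).
    rewrite subUset sub1set Bb (subset_trans sXB sB') cardsU1 bX => /(_ isT).
    suff -> : undominated (A :\: N) X = undominated A (b |: X) by lia.
    apply/setP=> a; rewrite !inE; case: (a \in A); rewrite ?andbF //= andbT.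
    apply/andP/forall_inP => [[ab /forall_inP aX] d|aX].
      by rewrite !inE => /orP[/eqP->//|/aX].
    split; first by apply: aX; rewrite !inE eqxx.
    by apply/forall_inP=> d dX; apply: aX; rewrite !inE dX orbT.
  - have := cardsID N A; have := cardsU Y (A :&: N); lia.
(* Adjoining [b] as a generator moves it from [B] to [Y]; the vertex count and [t] are unchanged. *)
apply: (acyclic_eq_ideal _ (IH A (B :\ b) (b |: Y) t cB' _ _ _ _)).
- move=> m; apply/bip_monomialP/orP.
    case=> [[y]|[a [d [Aa]]]].
      rewrite !inE => /orP[/eqP->|Yy] my; [by right | left].
      by apply/bip_monomialP; left; exists y.
    by rewrite !inE => /andP[_ Bd] ad ma md; left; apply/bip_monomialP; right; exists a, d.
  case=> [/bip_monomialP[[y Yy my]|[a [d [Aa Bd ad ma md]]]]|mb].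
  - by left; exists y; rewrite // !inE Yy orbT.
  - have [db|db] := eqVneq d b; last by right; exists a, d; split; rewrite // !inE db.
    by left; exists b; rewrite ?set11 // -?db // !inE eqxx.
  by left; exists b; rewrite // !inE eqxx.
- exact: disjointWl dBA.
- rewrite disjoints_subset; apply/subsetP=> x; rewrite !inE => /andP[xb Bx].
  by rewrite negb_or xb (disjointFr dBY Bx).
- by move=> X sXB; apply: tX; apply: subset_trans sXB sB'.
- by rewrite cardsU1 bY; lia.
Qed.

End BipartiteDepth.

(** * Dimension shifting along a resolution *)

Section RowImage.
Variables (R : comNzRingType) (r' r : nat) (phi : 'M[R]_(r', r)).

Definition row_image (u : 'rV[R]_r) : Prop := exists w, u = w *m phi.

Lemma row_image_submodule : submodule row_image.
Proof.
split=> [|a u v [u' ->] [v' ->]]; first by exists 0; rewrite mul0mx.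
by exists (a *: u' + v'); rewrite mulmxDl -scalemxAl.
Qed.

Lemma rows_imageP k (z : 'M_(k, r)) :
  rows row_image z <-> exists y, z = y *m phi.
Proof.
split=> [|[y ->] i]; first exact: rows_lift.
by exists (row i y); rewrite row_mul.
Qed.

End RowImage.

Lemma rows_kernel (R : comNzRingType) r'' r' r (psi : 'M[R]_(r'', r'))
    (phi : 'M[R]_(r', r)) k (z : 'M_(k, r')) :
  (forall u, u *m phi = 0 <-> row_image psi u) ->
  rows (row_image psi) z <-> z *m phi = 0.
Proof.
move=> exact; split=> [Nz|z0 i].
  by apply/row_matrixP=> i; rewrite row0 row_mul; apply/exact.
by apply/exact; rewrite -row_mul z0 row0.
Qed.

Section DimensionShift.
Variables (K : fieldType) (n : nat).
Local Notation R := {mpoly K[n]}.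

(** The exterior product of all basis vectors, of degree [size s]. *)
Fixpoint ktop (s : seq 'I_n) : 'M[R]_(ksize s, 1) :=
  if s is _ :: s' then col_mx 0 (ktop s') else 1%:M.

(** The unit of the exterior algebra, of degree 0. *)
Fixpoint kbot (s : seq 'I_n) : 'M[R]_(ksize s, 1) :=
  if s is _ :: s' then col_mx (kbot s') 0 else 1%:M.

Lemma kgrade_top s : kgrade K s (size s) *m ktop s = ktop s.
Proof.
elim: s => [|x s IH]; first by rewrite /= mul1mx.
by rewrite kgrade_cons mulmx0 intS addrAC subrr add0r IH.
Qed.

Lemma kgrade_bot s : kgrade K s 0 *m kbot s = kbot s.
Proof.
elim: s => [|x s IH]; first by rewrite /= mul1mx.
by rewrite kgrade_cons mulmx0 IH.
Qed.

Lemma ktop_eq1 s : exists i, ktop s i 0 = 1.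
Proof.
elim: s => [|x s [i IH]]; first by exists 0; rewrite mxE.
by exists (rshift _ i); rewrite /= col_mxEd.
Qed.

Lemma kbot_eq1 s : exists i, kbot s i 0 = 1.
Proof.
elim: s => [|x s [i IH]]; first by exists 0; rewrite mxE.
by exists (lshift _ i); rewrite /= col_mxEu.
Qed.

Section Exact.
Variables (r'' r' r : nat) (psi : 'M[R]_(r'', r')) (phi : 'M[R]_(r', r)).
Hypothesis exact_phi : forall u, u *m phi = 0 <-> row_image psi u.

(** By exactness coker psi is isomorphic to im phi. In the long exact sequence of 0 -> im phi -> R^r
    -> coker phi -> 0, the map from H_i(im phi) to H_i(R^r) is zero: the target vanishes for
    [i > 0], and for [i = 0] the entries of [phi] lie in (s). *)
Lemma acyclic_kernel s i :
  uniq s -> 0 < i \/ i = 0 /\ (forall j l, monomial_ideal (meets s) (phi j l)) ->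
  acyclic s (i + 1) (row_image phi) -> acyclic s i (row_image psi).
Proof.
move=> Us i_ge0 acyP z zi /(rows_kernel _ exact_phi); rewrite -mulmxA => Dz.
have zphii : kgrade K s i *m (z *m phi) = z *m phi by rewrite mulmxA zi.
have [y Dy] : exists y, z *m phi = koszul K s *m y.
  case: i_ge0 => [i_gt0|[i0 mphi]].
    have [|y /rows_zero/eqP] := @koszul_acyclic K n s i r Us i_gt0 _ zphii; first exact/rows_zero.
    by rewrite subr_eq0 => /eqP; exists y.
  apply: koszul_boundary0; first by rewrite -[in LHS]i0.
  have upm := @meets_upclosed n s; apply/ideal_rowsP=> j l; rewrite mxE.
  by apply: monomial_ideal_sum => a _; apply: monomial_idealM.
have {}Dy := koszul_boundary_lift zphii Dy; set y' := _ *m y in Dy.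
have [|w /rows_imageP[v Dv]] := acyP y' (kgradeP _ _).
  by apply/rows_imageP; exists z.
exists v; apply/(rows_kernel _ exact_phi).
by rewrite mulmxBl Dy -mulmxA -Dv mulmxBr koszulKx subr0 subrr.
Qed.

(** The same long exact sequence: H_{i+1}(R^r) = 0 embeds H_{i+1}(coker phi) into H_i(im phi), which
    is H_i(coker psi). *)
Lemma acyclic_cokernel s i : uniq s -> 0 < i ->
  acyclic s i (row_image psi) -> acyclic s (i + 1) (row_image phi).
Proof.
move=> Us i_gt0 acyP z zi /rows_imageP[y Dy].
pose y' := kgrade K s i *m y.
have {}Dy : koszul K s *m z = y' *m phi.
  by rewrite -mulmxA -Dy koszul_graded.
have [|w Dw] := acyP y' (kgradeP _ _).
  by apply/(rows_kernel _ exact_phi); rewrite -mulmxA -Dy koszulKx.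
pose w' := kgrade K s (i + 1) *m w.
have {}Dw : y' *m phi = koszul K s *m (w' *m phi).
  move/(rows_kernel _ exact_phi)/eqP: Dw; rewrite mulmxBl subr_eq0 => /eqP Dw.
  rewrite mulmxA [koszul K s *m w']mulmxA koszul_kgrade addrK.
  by rewrite -2!(mulmxA (kgrade K s i)) -Dw mulmxA kgradeP.
have i1_gt0 : 0 < i + 1 by apply: addr_gt0.
have [||u /rows_zero/eqP] := @koszul_acyclic K n s _ r Us i1_gt0 (z - w' *m phi).
- by rewrite mulmxBr zi mulmxA kgradeP.
- by apply/rows_zero; rewrite mulmxBr Dy Dw subrr.
rewrite subr_eq0 => /eqP Du; exists u; apply/rows_imageP; exists w'.
by rewrite -Du subKr.
Qed.

End Exact.
End DimensionShift.

(** * Ranks in a minimal resolution against Koszul homology *)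

Section MinimalResolution.
Variables (K : fieldType) (n : nat).
Local Notation R := {mpoly K[n]}.
Variables (P : pred 'X_{1..n}) (I : R -> Prop) (F : min_res I).
Hypothesis upP : upclosed P.
Hypothesis IP : forall p, I p <-> monomial_ideal P p.

Local Notation im j := (row_image (res_map F j)).
Local Notation NI := (@ideal_rows K n P 1).

Let subNI : submodule NI. Proof. exact: ideal_rows_submodule. Qed.

(** The augmentation identifies F_0 / [im 0] with R/I. The next two lemmas transport acyclicity
    along this isomorphism, a preimage [v] of 1 providing the inverse. *)
Lemma rows_aug k (z : 'M[R]_(k, res_rank F 0)) :
  rows NI (z *m res_aug F) <-> rows (im 0) z.
Proof.
split=> Nz i.
  by apply/(res_exact0 (m:=F)); apply/IP; have := Nz i 0; rewrite row_mul.
by rewrite row_mul => j; rewrite ord1; apply/IP/(res_exact0 (m:=F))/Nz.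
Qed.

Lemma acyclic_aug s i : acyclic s i NI -> acyclic s i (im 0).
Proof.
move=> acyI z zi Nz.
have [||w Nw] := acyI (z *m res_aug F).
- by rewrite mulmxA zi.
- by rewrite mulmxA; apply/rows_aug.
have [v Dv] : exists v : 'rV_(res_rank F 0), monomial_ideal P ((v *m res_aug F) 0 0 - 1).
  by have [v /IP Iv] := res_aug_surj F; exists v.
exists (w *m v); apply/rows_aug; rewrite mulmxBl -!mulmxA.
have [e De] : exists e, v *m res_aug F = 1%:M + e.
  by exists (v *m res_aug F - 1%:M); rewrite addrC subrK.
rewrite De in Dv *.
rewrite !mulmxDr mulmx1 opprD addrA; apply: rowsB => //.
apply: rows_mull => //; apply: rows_mull => // a b; rewrite !ord1.
by move: Dv; rewrite !mxE mulr1n addrAC subrr add0r.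
Qed.

Lemma acyclic_unaug s i : acyclic s i (im 0) -> acyclic s i NI.
Proof.
move=> acyI z zi Nz.
have [v Dv] := res_aug_surj F; move/IP: Dv => Dv.
have Dz : rows NI (z - z *m v *m res_aug F).
  rewrite -[X in rows _ (X - _)]mulmx1 -mulmxA -mulmxBr; apply: rows_mull => //.
  rewrite -opprB; apply: rowsN => // a b.
  by rewrite !ord1; rewrite !mxE in Dv *; rewrite mulr1n.
have [||w Nw] := acyI (z *m v).
- by rewrite mulmxA zi.
- apply/rows_aug.
  have -> : koszul K s *m (z *m v) *m res_aug F =
      koszul K s *m z - koszul K s *m (z - z *m v *m res_aug F).
    by rewrite mulmxBr subKr !mulmxA.
  by apply: rowsB => //; apply: rows_mull.
exists (w *m res_aug F); rewrite -[z](subrK (z *m v *m res_aug F)) -addrA.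
apply: rowsD => //; rewrite mulmxA -mulmxBl; exact/rows_aug.
Qed.

(** Shifting [i] times turns H_i(R/I) = 0 into H_0(F_i / [im i]) = 0 for all variables. Since [im i]
    lies in the maximal ideal times F_i by minimality, so would all of F_i, which forces rank 0. *)
Lemma rank_eq0_of_acyclic (i : nat) :
  acyclic (enum 'I_n) i NI -> res_rank F i = 0%N.
Proof.
move=> acyI; set s := enum 'I_n.
have upm := @meets_upclosed n s.
have m0 (p : R) : p@_0%MM = 0 <-> monomial_ideal (meets s) p.
  split=> [p0|/monomial_idealP Pp].
    apply/monomial_idealP=> m pm; apply/hasP.
    have [m0|/negP] := boolP [forall x, m x == 0%N].
      suff Dm : m = 0%MM by rewrite Dm p0 eqxx in pm.
      by apply/mnmP=> x; rewrite mnm0E; apply/eqP/(forallP m0).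
    by move/negP; rewrite negb_forall => /existsP[x mx]; exists x; rewrite ?mem_enum.
  apply/eqP/negP=> /negP /Pp /hasP[x _]; by rewrite mnm0E.
have minF j a b : monomial_ideal (meets s) (res_map F j a b).
  exact/m0/res_minimal.
have acyF j : (j <= i)%N -> acyclic s (i%:Z - j%:Z) (im j).
  elim: j => [|j IH] le_ji; first by rewrite subr0; apply: acyclic_aug.
  apply: (acyclic_kernel (res_exact (m:=F) (i:=j))); first exact: enum_uniq.
    by case: (ltrP 0 (i%:Z - j.+1%:Z)) => [|le0]; [left | right; split; [lia |]].
  have -> : i%:Z - j.+1%:Z + 1 = i%:Z - j%:Z by lia.
  exact/IH/ltnW.
have := acyF i (leqnn i); rewrite subrr => acyi.
case Dr: (res_rank F i) => [//|r].
have c : 'I_(res_rank F i) by rewrite Dr; apply: ord0.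
(* The basis vector [c] of F_i, placed in Koszul degree 0, is a cycle; being a boundary modulo
   [im i] would put its coefficient 1 in the maximal ideal. *)
have [||w /rows_imageP[y Dy]] := acyi (kbot K s *m delta_mx 0 c).
- by rewrite mulmxA kgrade_bot.
- by rewrite koszul_kgrade0 ?mulmxA ?kgrade_bot //; apply: rows0; apply: row_image_submodule.
have [b Db] := kbot_eq1 K s.
have : monomial_ideal (meets s) ((kbot K s *m delta_mx 0 c) b c).
  rewrite -[_ *m delta_mx 0 c](subrK (koszul K s *m w)) Dy !mxE.
  rewrite monomial_idealD //; first by apply: monomial_ideal_sum => a _; apply: monomial_idealM.
  by have /ideal_rowsP/(_ b c) := koszul_boundary_meets w; rewrite mxE.
rewrite mxE big_ord1 Db mul1r mxE !eqxx => /m0/eqP.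
by rewrite mcoeff1 eqxx oner_eq0.
Qed.

(** If F_i = 0 for [i = size s > 0], then F_{i-1} / [im i.-1] is free, so its H_1 vanishes, and
    shifting back gives H_i(R/I) = 0. But [f *: ktop K s] is a cycle of top degree, and it is a
    boundary modulo I only if [f] is in I. *)
Lemma rank_neq0_of_socle s (f : R) : uniq s ->
  (forall x, x \in s -> monomial_ideal P ('X_x * f)) -> ~~ monomial_ideal P f ->
  res_rank F (size s) != 0%N.
Proof.
move=> Us If If0; apply/negP=> /eqP rk0; case/negP: If0.
have acyI : acyclic s (size s) NI.
  apply: acyclic_unaug; move: rk0.
  have im0 j : res_rank F j.+1 = 0%N -> forall i, 0 < i -> acyclic s i (im j).
    move=> rk0 i i_gt0; apply: (acyclic_ext _ (@koszul_acyclic K n s i _ Us i_gt0)) => u.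
    split=> [->|[w ->]]; first by exists 0; rewrite mul0mx.
    apply/rowP=> l; rewrite !mxE big1 // => a _.
    by have := ltn_ord a; rewrite [X in (_ < X)%N]rk0.
  (* With [s] empty, F_0 itself is zero and every row vector condition is vacuous. *)
  case: (size s) => [|h] rk0.
    move=> z _ _; exists 0 => j; exists 0; apply/rowP=> l.
    by have := ltn_ord l; rewrite [X in (_ < X)%N]rk0.
  have up j : (j <= h)%N -> acyclic s j.+1 (im (h - j)).
    elim: j => [|j IH] le_jh; first by rewrite subn0; apply: im0.
    rewrite intS addrC; apply: (acyclic_cokernel (res_exact (m:=F) (i:=(h - j.+1)%N))) => //.
    by rewrite subnSK //; apply/IH/ltnW.
  by have := up h (leqnn h); rewrite subnn.
have [||w Nw] := acyI (f *: ktop K s).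
- by rewrite -scalemxAr kgrade_top.
- apply: koszul_rows => // x xs; apply/ideal_rowsP=> a b.
  by rewrite scalerA mxE mulrC; apply: monomial_idealM => //; apply: If.
(* Projection to top degree kills the boundary, as there are no chains of degree [size s + 1]. *)
have : rows NI (kgrade K s (size s) *m (f *: ktop K s - koszul K s *m w)).
  exact: rows_mull.
rewrite mulmxBr -scalemxAr kgrade_top mulmxA -[X in kgrade K s X](addrK 1) -koszul_kgrade.
rewrite kgrade_gt_size ?ltrDl // mulmx0 mul0mx subr0 => /ideal_rowsP Nf.
by have [b Db] := ktop_eq1 K s; have := Nf b 0; rewrite mxE Db mulr1.
Qed.

End MinimalResolution.

(** * Noetherianity of polynomial rings *)

(** Induction on the number [d] of coordinates compared. Let [A] be the largest new coordinate in
    the family [s] for [d]. Elements with new coordinate at least [A] are dominated by [s]; the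
    others fall into finitely many slices of constant new coordinate, each handled by induction. *)
Lemma dickson n (T : eqType) (Q : T -> Prop) (f : T -> 'X_{1..n}) :
  exists s : seq T, (forall x, x \in s -> Q x) /\
    forall x, Q x -> exists2 y, y \in s & (f y <= f x)%MM.
Proof.
suff /(_ n Q)[s [sQ Qs]] d : forall Q : T -> Prop, exists s : seq T,
    (forall x, x \in s -> Q x) /\ forall x, Q x -> exists2 y, y \in s &
      forall i : 'I_n, (i < d)%N -> (f y i <= f x i)%N.
  exists s; split=> // x /Qs[y sy le_yx]; exists y => //.
  by apply/mnm_lepP => i; apply: le_yx.
elim: d => [|d IH] {}Q.
  case: (classic (exists x, Q x)) => [[x Qx]|nQ].
    by exists [:: x]; split=> [y|y _]; [rewrite inE => /eqP-> | exists x; rewrite ?inE].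
  by exists [::]; split=> // x Qx; case: nQ; exists x.
case: (ltnP d n) => [lt_dn|le_nd]; last first.
  have [s [sQ Qs]] := IH Q; exists s; split=> // x /Qs[y sy le_yx].
  by exists y => // i _; apply: le_yx; apply: leq_trans (ltn_ord i) le_nd.
pose j := Ordinal lt_dn.
have ltS (i : 'I_n) : (i < d.+1)%N -> (i < d)%N \/ i = j.
  rewrite ltnS leq_eqVlt => /orP[/eqP id|]; [right | by left].
  exact: val_inj.
have [s [sQ Qs]] := IH Q.
pose A := (\max_(x <- s) f x j)%N.
have [t [tQ Qt]] : exists t : seq T, (forall x, x \in t -> Q x) /\
    forall x, Q x -> (f x j < A)%N -> exists2 y, y \in t &
      forall i : 'I_n, (i < d.+1)%N -> (f y i <= f x i)%N.
  elim: A => [|a [t [tQ Qt]]]; first by exists [::].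
  have [t' [t'Q Qt']] := IH (fun x => Q x /\ f x j = a).
  exists (t' ++ t); split=> [x|x Qx].
    by rewrite mem_cat => /orP[/t'Q[]|/tQ].
  rewrite ltnS leq_eqVlt => /orP[/eqP xa|/(Qt x Qx)[y ty le_yx]]; last first.
    by exists y; rewrite // mem_cat ty orbT.
  have [y t'y le_yx] := Qt' x (conj Qx xa).
  exists y => [|i /ltS[/le_yx//|->]]; first by rewrite mem_cat t'y.
  by have [_ ->] := t'Q y t'y; rewrite xa.
exists (s ++ t); split=> [x|x Qx]; first by rewrite mem_cat => /orP[/sQ|/tQ].
case: (ltnP (f x j) A) => [/(Qt x Qx)[y ty le_yx]|le_Ax].
  by exists y; rewrite // mem_cat ty orbT.
have [y sy le_yx] := Qs x Qx; exists y => [|i /ltS[/le_yx//|->]].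
  by rewrite mem_cat sy.
apply: leq_trans le_Ax; exact: (@leq_bigmax_seq _ s xpredT (fun y => f y j) y).
Qed.

Section Noetherian.
Variables (K : fieldType) (n : nat).
Local Notation R := {mpoly K[n]}.

(** Generation is phrased through all submodules containing [s], which avoids explicit
    coefficients. *)
Definition generates r (s : seq 'rV[R]_r) (N : 'rV[R]_r -> Prop) : Prop :=
  (forall u, u \in s -> N u) /\
  forall M, submodule M -> (forall u, u \in s -> M u) -> forall u, N u -> M u.

(** One division step: [c] is the quotient of the leading terms, so the leading terms cancel. *)
Lemma mpoly_reduce (p q : R) : p != 0 -> q != 0 -> (mlead q <= mlead p)%MM ->
  exists c : R, p - c * q != 0 -> (mlead (p - c * q) < mlead p)%O.
Proof.
move=> p0 q0 le_qp.
pose a : K := mleadc p / mleadc q; pose m := (mlead p - mlead q)%MM.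
have a0 : a != 0 by rewrite mulf_neq0 ?invr_eq0 ?mleadc_eq0.
exists (a *: 'X_[m]) => d0.
have lead_m : mlead (a *: 'X_[m] * q) = mlead p.
  have X0 : 'X_[m] != 0 :> R by rewrite -msupp_eq0 msuppX.
  by rewrite mleadM ?mleadZ ?mleadXm ?submK // scaler_eq0 negb_or a0.
rewrite lt_neqAle; apply/andP; split; last first.
  by apply: le_trans (mleadB_le _ _) _; rewrite lead_m joinxx.
apply: contraNneq d0 => lead_d; rewrite -mleadc_eq0 lead_d mcoeffB -scalerAl mcoeffZ.
have -> : ('X_[m] * q)@_(mlead p) = mleadc q.
  by rewrite -[mlead p](submK le_qp) -/m mulrC mcoeffMX.
by rewrite mulfVK ?mleadc_eq0 // subrr.
Qed.

(** Filter [N] by the vectors vanishing from coordinate [d] on. For the last coordinate allowed,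
    [dickson] yields finitely many vectors whose leading exponents there divide all others; division
    by them, well-founded on leading exponents, reaches the previous level. *)
Lemma submodule_fg r (N : 'rV[R]_r -> Prop) : submodule N ->
  exists s : seq 'rV[R]_r, generates s N.
Proof.
move=> subN; pose Nd d (u : 'rV[R]_r) := N u /\ forall i : 'I_r, (d <= i)%N -> u 0 i = 0.
suff [s [sN Ns]] : exists s, generates s (Nd r).
  exists s; split=> [u /sN[]//|M subM Ms u Nu]; apply: Ns => //; split=> // i.
  by rewrite leqNgt ltn_ord.
have subNd d : submodule (Nd d).
  split=> [|a u v [Nu u0] [Nv v0]]; first by split=> [|i _]; [case: subN | rewrite mxE].
  by split=> [|i di]; [apply: subN.2 | rewrite !mxE u0 // v0 // mulr0 addr0].
suff: forall d, (d <= r)%N -> exists s, generates s (Nd d) by apply.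
elim=> [_|d IH lt_dr].
  exists [::]; split=> // M subM _ u [_ u0].
  suff -> : u = 0 by case: subM.
  by apply/rowP=> i; rewrite u0 // mxE.
have [s [sNd Nds]] := IH (ltnW lt_dr); pose j := Ordinal lt_dr.
have [t [tQ Qt]] := @dickson n _ (fun u => Nd d.+1 u /\ u 0 j != 0) (fun u => mlead (u 0 j)).
exists (t ++ s); split=> [u|M subM Mts].
  rewrite mem_cat => /orP[/tQ[]//|/sNd[Nu u0]]; split=> // i /ltnW; exact: u0.
have Mt u : u \in t -> M u by move=> tu; apply: Mts; rewrite mem_cat tu.
have Ms u : u \in s -> M u by move=> su; apply: Mts; rewrite mem_cat su orbT.
have M0 u : Nd d.+1 u -> u 0 j = 0 -> M u.
  move=> [Nu u0] uj; apply: Nds => //; split=> // i.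
  rewrite leq_eqVlt => /orP[/eqP di|]; last exact: u0.
  by rewrite -uj; congr (u 0 _); apply: val_inj.
move=> u; move Dm: (mlead (u 0 j)) => m.
elim/(@ltmwf n): m u Dm => m IHm u Dm Nu.
have [uj|uj] := eqVneq (u 0 j) 0; first exact: M0.
have [v tv le_vu] := Qt u (conj Nu uj); have [Nv vj] := tQ v tv.
have [c lt_c] := mpoly_reduce uj vj le_vu.
rewrite -[u](subrK (c *: v)); apply: submoduleD => //; last by apply: submoduleZ => //; apply: Mt.
have Nuv : Nd d.+1 (u - c *: v).
  by rewrite addrC -scaleNr; apply: (subNd d.+1).2.
have [uvj|uvj] := eqVneq (u 0 j - c * v 0 j) 0; first by apply: M0; rewrite // !mxE.
by apply: IHm (erefl _) Nuv; rewrite !mxE -Dm; apply: lt_c.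
Qed.

End Noetherian.

(** * Existence of minimal resolutions *)

Lemma classical_min (P : nat -> Prop) : (exists k, P k) ->
  exists2 k, P k & forall l, (l < k)%N -> ~ P l.
Proof.
case=> k; elim/ltn_ind: k => k IH Pk.
case: (classic (exists2 l, (l < k)%N & P l)) => [[l lk Pl]|nP]; first exact: IH Pl.
by exists k => // l lk Pl; apply: nP; exists l.
Qed.

(** * Homogeneous components and minimal homogeneous generators *)

Section GradedModules.
Variables (K : fieldType) (n : nat).
Local Notation R := {mpoly K[n]}.

Definition mfilter (Q : pred 'X_{1..n}) (p : R) : R :=
  \sum_(m <- msupp p | Q m) p@_m *: 'X_[m].

Lemma mcoeff_filter Q p m : (mfilter Q p)@_m = if Q m then p@_m else 0.
Proof.
rewrite raddf_sum /= big_mkcond; have [pm|pm] := boolP (m \in msupp p).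
  rewrite (bigD1_seq m) ?msupp_uniq //= big1 => [|m' m'm].
    by rewrite mcoeffZ mcoeffX eqxx mulr1 addr0.
  by rewrite mcoeffZ mcoeffX (negPf m'm) mulr0; case: ifP.
rewrite (memN_msupp_eq0 pm) if_same big_seq big1 // => m' pm'.
rewrite mcoeffZ mcoeffX; case: eqP pm pm' => [->|]; first by move/negPf->.
by rewrite mulr0; case: ifP.
Qed.

Section Degrees.
Variables (r : nat) (deg : 'I_r -> int).

Definition homogeneous (D : int) (u : 'rV[R]_r) : Prop :=
  forall c m, m \in msupp (u 0 c) -> deg c + (mdeg m)%:Z = D.

Definition component (D : int) (u : 'rV[R]_r) : 'rV[R]_r :=
  \row_c mfilter (fun m => deg c + (mdeg m)%:Z == D) (u 0 c).

Definition graded (N : 'rV[R]_r -> Prop) : Prop :=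
  forall D u, N u -> N (component D u).

Lemma component_homogeneous D u : homogeneous D (component D u).
Proof.
by move=> c m; rewrite mcoeff_msupp mxE mcoeff_filter; case: ifP => [/eqP//|_]; rewrite eqxx.
Qed.

Lemma sum_components u : exists Ds : seq int, u = \sum_(D <- Ds) component D u.
Proof.
exists (undup [seq deg p.1 + (mdeg p.2)%:Z |
  p <- [seq (c, m) | c <- enum 'I_r, m <- msupp (u 0 c)]]).
set Ds := undup _; apply/rowP=> c; rewrite summxE; apply/mpolyP=> m.
rewrite raddf_sum /=; have [um|um] := boolP (m \in msupp (u 0 c)).
  rewrite (bigD1_seq (deg c + (mdeg m)%:Z)) ?undup_uniq //=; last first.
    rewrite mem_undup; apply/mapP; exists (c, m) => //.
    by apply/allpairsPdep; exists c, m; rewrite mem_enum.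
  rewrite mxE mcoeff_filter eqxx big1 ?addr0 // => D; rewrite eq_sym => nD.
  by rewrite mxE mcoeff_filter (negPf nD).
rewrite (memN_msupp_eq0 um) big1 // => D _.
by rewrite mxE mcoeff_filter (memN_msupp_eq0 um) if_same.
Qed.

End Degrees.

(** A map of degree 0 commutes with homogeneous components. If [m2] occurs in [phi a c], then a
    product of [m1] and [m2] has degree D in column [c] exactly when [m1] has degree D in column
    [a]. *)
Lemma component_mulmx r (deg : 'I_r -> int) k (deg' : 'I_k -> int)
    (phi : 'M[R]_(k, r)) D w :
  (forall a, homogeneous deg (deg' a) (row a phi)) ->
  component deg D (w *m phi) = component deg' D w *m phi.
Proof.
move=> homphi; apply/rowP=> c; apply/mpolyP=> m; rewrite !mxE mcoeff_filter.
rewrite !(raddf_sum (mcoeff m)) /=.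
rewrite (_ : (if _ then _ else _) =
    \sum_a (if deg c + (mdeg m)%:Z == D then (w 0 a * phi a c)@_m else 0)); last first.
  by case: ifP => // _; rewrite big1.
apply: eq_bigr => a _; rewrite mxE !mcoeffM.
rewrite (_ : (if _ then _ else _) = \sum_(p : 'X_{1..n < (mdeg m).+1, (mdeg m).+1} |
    m == (p.1 + p.2)%MM) (if deg c + (mdeg m)%:Z == D then
      (w 0 a)@_p.1 * (phi a c)@_p.2 else 0)); last first.
  by case: ifP => // _; rewrite big1.
apply: eq_bigr => -[m1 m2] /= /eqP; move: (bmnm m1) (bmnm m2) => {}m1 {}m2 Dm.
rewrite mcoeff_filter.
have [->|pm2] := eqVneq (phi a c)@_m2 0; first by rewrite !mulr0 if_same.
have Da : deg c + (mdeg m2)%:Z = deg' a by apply: homphi; rewrite mxE mcoeff_msupp.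
rewrite Dm mdegD PoszD addrCA Da [_%:Z + _]addrC.
by case: ifP; rewrite ?mul0r.
Qed.

(** Each generator is replaced by its homogeneous components, which stay in the graded [N]. *)
Lemma homogeneous_generators r (deg : 'I_r -> int) (N : 'rV[R]_r -> Prop)
    (s : seq 'rV[R]_r) :
  graded deg N -> (forall u, u \in s -> N u) ->
  exists t : seq (int * 'rV[R]_r),
    (forall p, p \in t -> homogeneous deg p.1 p.2 /\ N p.2) /\
    forall M, submodule M -> (forall p, p \in t -> M p.2) -> forall u, u \in s -> M u.
Proof.
move=> grN; elim: s => [|u s IH] sN; first by exists [::].
have [|t [tN ts]] := IH; first by move=> v sv; apply: sN; rewrite inE sv orbT.
have [Ds Du] := sum_components deg u.
exists ([seq (D, component deg D u) | D <- Ds] ++ t); split=> [p|M subM Mt v].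
  rewrite mem_cat => /orP[/mapP[D _ ->]|/tN//]; split.
    exact: component_homogeneous.
  by apply: grN; apply: sN; rewrite mem_head.
rewrite inE => /orP[/eqP->|sv]; last first.
  by apply: (ts M) sv => // p tp; apply: Mt; rewrite mem_cat tp orbT.
rewrite Du big_seq; apply: (big_ind M) => [||D DsD].
- by case: subM.
- exact: submoduleD.
by apply: (Mt (D, component deg D u)); rewrite mem_cat map_f.
Qed.

(* A homogeneous generating family of least size has only relations with
   coefficients in the maximal ideal: a relation with an invertible
   coefficient would make one generator superfluous. *)
Lemma minimal_generators r (deg : 'I_r -> int) (N : 'rV[R]_r -> Prop) :
  submodule N -> graded deg N ->
  exists (k : nat) (deg' : 'I_k -> int) (phi : 'M[R]_(k, r)),
    [/\ forall a, homogeneous deg (deg' a) (row a phi),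
        forall u, N u <-> row_image phi u
      & forall (w : 'rV_k) a, w *m phi = 0 -> (w 0 a)@_0%MM = 0 ].
Proof.
move=> subN grN.
pose gens k := exists t : seq (int * 'rV[R]_r),
  [/\ size t = k, forall p, p \in t -> homogeneous deg p.1 p.2 /\ N p.2
    & forall M, submodule M -> (forall p, p \in t -> M p.2) -> forall u, N u -> M u].
have [|k [t [Dk tN Nt]] mink] := @classical_min gens.
  have [s [sN Ns]] := submodule_fg subN.
  have [t [tN ts]] := homogeneous_generators grN sN.
  exists (size t), t; split=> // M subM Mt; apply: Ns => //; exact: ts Mt.
pose g (a : 'I_k) := nth (0, 0) t a.
have tg a : g a \in t by apply: mem_nth; rewrite Dk.
have tP p : p \in t -> exists a, p = g a.
  by move=> /(nthP (0, 0))[a]; rewrite Dk => lt_a <-; exists (Ordinal lt_a).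
pose phi := \matrix_a (g a).2.
have homphi a : homogeneous deg (g a).1 (row a phi).
  by rewrite rowK; case: (tN _ (tg a)).
exists k, (fun a => (g a).1), phi; split=> // [u|w a w0].
  split=> [Nu|[w ->]].
    apply: (Nt _ (row_image_submodule phi)) Nu => p /tP[a ->].
    by exists (delta_mx 0 a); rewrite -rowE rowK.
  rewrite mulmx_sum_row; apply: submodule_sum => // a.
  by apply: submoduleZ => //; rewrite rowK; case: (tN _ (tg a)).
apply/eqP/negP=> /negP wa0.
(* In degree [D] the relation keeps only the constant term of its coefficient at [a], so this
   coefficient becomes a nonzero scalar. *)
pose D := (g a).1; pose w' := component (fun b => (g b).1) D w.
have w'0 : w' *m phi = 0.
  rewrite -(component_mulmx _ _ homphi) w0; apply/rowP=> c; rewrite !mxE.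
  by apply/mpolyP=> m; rewrite mcoeff_filter mcoeff0 if_same.
have w'a : w' 0 a = ((w 0 a)@_0%MM)%:MP.
  apply/mpolyP=> m; rewrite mxE mcoeff_filter mcoeffC -[X in _ == X]addr0.
  rewrite (inj_eq (addrI _)) eqz_nat mdeg_eq0.
  by case: eqP => [->|]; rewrite ?mulr1 ?mulr0.
have k_gt0 : (0 < k)%N by apply: leq_ltn_trans (ltn_ord a).
(* Solving for [g a] leaves the other k - 1 generators, against the minimality of [k]. *)
apply: (mink k.-1); first by rewrite prednK.
exists [seq g b | b in predC1 a]; split=> [|p /imageP[b _ ->]|M subM Mt].
- by rewrite size_image cardC1 card_ord.
- exact: tN.
apply: (Nt M) => // _ /tP[b ->]; have Mg d : d != a -> M (g d).2.
  by move=> da; apply: Mt; apply: image_f.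
have [->|] := eqVneq b a; last exact: Mg.
move/eqP: w'0; rewrite mulmx_sum_row (bigD1 a) //= addr_eq0 w'a rowK => /eqP Dga.
have -> : (g a).2 = ((w 0 a)@_0%MM)^-1%:MP *: (((w 0 a)@_0%MM)%:MP *: (g a).2).
  by rewrite scalerA -mpolyCM mulVf // scale1r.
rewrite Dga; apply: submoduleZ => //; rewrite -scaleN1r; apply: submoduleZ => //.
apply: (big_ind M) => [||d da]; [by case: subM | exact: submoduleD |].
by rewrite rowK; apply: submoduleZ => //; apply: Mg.
Qed.

End GradedModules.

(** * Construction of the resolution, one syzygy module at a time *)

Section Resolution.
Variables (K : fieldType) (n : nat).
Local Notation R := {mpoly K[n]}.

(** A graded free module F_i with the graded submodule still to be covered: the ideal for [i = 0],
    afterwards the kernel of the previous map. [stage_minimal] places it in the maximal ideal times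
    F_i. *)
Record stage := Stage {
  stage_rank : nat;
  stage_deg : 'I_stage_rank -> int;
  stage_sub : 'rV[R]_stage_rank -> Prop;
  stage_submodule : submodule stage_sub;
  stage_graded : graded stage_deg stage_sub;
  stage_minimal : forall u c, stage_sub u -> (u 0 c)@_0%MM = 0 }.

Definition next_stage (S : stage) :=
  {S' : stage & 'M[R]_(stage_rank S', stage_rank S)}.

Definition next_stageP S (T : next_stage S) : Prop :=
  [/\ forall a, homogeneous (@stage_deg S) (stage_deg a) (row a (projT2 T)),
      forall u, stage_sub u <-> row_image (projT2 T) u
    & forall w, stage_sub w <-> w *m projT2 T = 0].

Lemma next_stage_exists S : exists T : next_stage S, next_stageP T.
Proof.
have [k [deg [phi [homphi Nphi minphi]]]] :=
  minimal_generators (stage_submodule S) (@stage_graded S).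
pose N (w : 'rV[R]_k) := w *m phi = 0.
have subN : submodule N.
  split=> [|a u v]; first by rewrite /N mul0mx.
  by rewrite /N mulmxDl -scalemxAl => -> ->; rewrite scaler0 addr0.
have grN : graded deg N.
  move=> D u; rewrite /N -(component_mulmx _ _ homphi) => ->; apply/rowP=> c; rewrite !mxE.
  by apply/mpolyP=> m; rewrite mcoeff_filter mcoeff0 if_same.
by exists (existT _ (Stage subN grN (fun w a => minphi w a)) phi).
Qed.

Definition step S : next_stage S :=
  proj1_sig (constructive_indefinite_description _ (next_stage_exists S)).

Lemma stepP S : next_stageP (step S).
Proof. by rewrite /step; case: constructive_indefinite_description. Qed.

(** Iterate [step] from the ideal inside R, with F_0 = R and the identity as augmentation. [~~ P 0]
    says that the ideal contains no constant but 0, so the first stage is minimal. *)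
Lemma min_res_exists (P : pred 'X_{1..n}) (I : R -> Prop) :
  upclosed P -> ~~ P 0%MM -> (forall p, I p <-> monomial_ideal P p) ->
  inhabited (min_res I).
Proof.
move=> upP P0 IP.
have gr0 : graded (fun=> 0) (@ideal_rows K n P 1).
  move=> D u Pu c; rewrite mxE; apply/monomial_idealP=> m.
  by rewrite mcoeff_filter; case: ifP => _; [apply/monomial_idealP | rewrite eqxx].
have min0 (u : 'rV[R]_1) c : ideal_rows P u -> (u 0 c)@_0%MM = 0.
  by move=> Pu; apply/eqP/(contraNT _ P0)/monomial_idealP.
pose S0 := Stage (@ideal_rows_submodule K n P upP 1) gr0 min0.
pose S i := iter i (fun S => projT1 (step S)) S0.
have SP i : next_stageP (step (S i)) by apply: stepP.
constructor; apply: (@MinRes K n I (fun i => stage_rank (S i))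
  (fun i => @stage_deg (S i)) (fun i => projT2 (step (S i))) 1%:M).
- by move=> i r c m rm; have [hom _ _] := SP i; apply: (hom r); rewrite mxE.
- by move=> r m; rewrite !ord1 mxE msupp1 inE => /eqP->; rewrite mdeg0.
- exists 1%:M; rewrite mulmx1 mxE subrr; apply/IP; exact: monomial_ideal0.
- move=> u; rewrite mulmx1 IP; have [_ Nu _] := SP 0%N.
  apply: iff_trans (Nu u : ideal_rows P u <-> _).
  by split=> [Pu c|Pu]; [rewrite ord1 | apply: (Pu 0)].
- move=> i u; have [_ _ Nu] := SP i; have [_ Nu' _] := SP i.+1.
  exact: iff_trans (iff_sym (Nu u)) (Nu' u).
- move=> i r c; have [_ Nphi _] := SP i.
  have := @stage_minimal (S i) (row r (projT2 (step (S i)))) c.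
  rewrite mxE; apply; apply/Nphi; exists (delta_mx 0 r); exact: rowE.
Qed.

End Resolution.

(** * Projective dimension of bipartite graphs *)

Section GraphProjdim.
Variables (K : fieldType) (G : sgraph) (A B : {set G}).
Hypothesis AB_setC : B = ~: A.
Hypothesis adj_bip : forall x y : G, adj x y -> (x \in A) != (y \in A).

Local Notation n := #|G|.
Local Notation P := (@bip_monomial G (@adj G) A B set0).

Lemma bip_edgeP (m : 'X_{1..n}) : reflect
  (exists x y : G, [/\ adj x y, m (enum_rank x) != 0%N & m (enum_rank y) != 0%N])
  (P m).
Proof.
apply: (iffP (bip_monomialP _ _ _ _ _)) => [[[y]|[a [b [_ _ ab ma mb]]]]|].
- by rewrite inE.
- by exists a, b.
case=> x [y [xy mx my]]; right; have := adj_bip xy.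
case: (boolP (x \in A)) => xA; case: (boolP (y \in A)) => yA // _.
  by exists x, y; rewrite AB_setC inE.
by exists y, x; rewrite adj_sym AB_setC inE.
Qed.

Lemma edge_idealP (p : {mpoly K[n]}) :
  @edge_ideal K G p <-> monomial_ideal P p.
Proof.
have upP : upclosed P by apply: bip_monomial_upclosed.
split=> [[c ->]|/allP Pp].
  apply: monomial_ideal_sum => x _; apply: monomial_ideal_sum => y xy.
  apply: monomial_idealM => //; rewrite /monomial_ideal -mpolyXD msuppX /= andbT.
  by apply/bip_edgeP; exists x, y; rewrite !mnmDE !mnm1E !eqxx !addn_eq0 !negb_and /= orbT.
rewrite [p]mpolyE big_seq; apply: big_ind => [|_ _ [c ->] [d ->]|m /Pp/bip_edgeP].
- by exists (fun _ _ => 0); rewrite big1 // => x _; rewrite big1 // => y _; rewrite mul0r.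
- exists (fun x y => c x y + d x y); rewrite -big_split; apply: eq_bigr => x _.
  by rewrite -big_split; apply: eq_bigr => y _; rewrite mulrDl.
case=> x [y [xy mx my]].
have yNx : y != x by apply: contraTneq xy => ->; rewrite adj_irr.
(* The monomial is divisible by both variables of an edge; as the endpoints differ, it is divisible
   by their product, and the quotient is the coefficient of this edge. *)
exists (fun x' y' => if (x' == x) && (y' == y) then
   p@_m *: 'X_[m - U_(enum_rank x) - U_(enum_rank y)] else 0).
rewrite (bigD1 x) //= (bigD1 y) //= !eqxx /=.
rewrite [X in _ + X + _]big1 ?addr0; last by move=> y' /andP[_ /negPf->]; rewrite mul0r.
rewrite big1 ?addr0; last by move=> x' /negPf x'x; rewrite big1 // => y' _; rewrite x'x mul0r.
rewrite -scalerAl /vertex_var -!mpolyXD; congr (_ *: 'X_[_]); apply/mnmP=> i.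
rewrite !mnmDE !mnmBE !mnm1E.
case: (enum_rank x =P i) => [Dx|_]; case: (enum_rank y =P i) => [Dy|_] /=.
- by case/eqP: yNx; apply: enum_rank_inj; rewrite Dx.
- by rewrite subn0 addn0 subnK // lt0n -Dx.
- by rewrite subn0 add0n subnK // lt0n -Dy.
by rewrite !subn0 !addn0.
Qed.

Lemma edge_ideal_res : inhabited (min_res (@edge_ideal K G)).
Proof.
apply: (@min_res_exists K n P); [exact: bip_monomial_upclosed | | exact: edge_idealP].
by apply/negP=> /bip_edgeP[x [y [_]]]; rewrite mnm0E.
Qed.

(** By contraposition: if no [X] satisfies the bound, [bip_acyclic] makes H_i vanish and F_i has
    rank 0. *)
Lemma betti_le i j : betti_neq0 (@edge_ideal K G) i j ->
  exists2 X : {set G}, X \subset B &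
    (i + (#|X| + #|undominated (@adj G) A X|) <= n)%N.
Proof.
case=> b [F <-] b0.
have [/exists_inP[X sXB le_n]|nX] := boolP [exists (X : {set G} | X \subset B),
  (i + (#|X| + #|undominated (@adj G) A X|) <= n)%N]; first by exists X.
have cAB : (#|A| + #|B|)%N = n by rewrite AB_setC cardsC.
have rk0 : res_rank F i = 0%N.
  apply: (@rank_eq0_of_acyclic K n P _ F _ edge_idealP); first exact: bip_monomial_upclosed.
  (* The failing bound says that every [X] costs at least [n.+1 - i], just enough for n < i + t; the
     truncated subtraction is harmless when [i] exceeds n + 1. *)
  apply: (@bip_acyclic _ _ _ _ _ _ _ (n.+1 - i)%N); first exact: enum_uniq.
  - by rewrite AB_setC disjoints_subset.
  - by rewrite disjoints_subset setC0 subsetT.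
  - move=> X sXB; move: nX; rewrite negb_exists => /forallP/(_ X).
    by rewrite sXB /= -ltnNge; lia.
  by rewrite cards0 cAB; lia.
case/negP: b0; rewrite cards_eq0; apply/eqP/setP=> r.
by have := ltn_ord r; rewrite [X in (_ < X)%N]rk0.
Qed.

(** Apply [rank_neq0_of_socle] to the product of the variables in [S]: independence keeps it out of
    the ideal, and domination makes every outside variable carry it into the ideal. *)
Lemma betti_neq0_codim (S : {set G}) :
  {in S &, forall x y, ~~ adj x y} ->
  (forall x, x \notin S -> exists2 y, y \in S & adj x y) ->
  exists j, betti_neq0 (@edge_ideal K G) #|~: S| j.
Proof.
move=> indS domS; have [F] := edge_ideal_res.
pose m := [multinom (enum_val i \in S : nat) | i < n].
have mE x : m (enum_rank x) = (x \in S) by rewrite mnmE enum_rankK.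
pose s := [seq enum_rank x | x <- enum (~: S)].
have : res_rank F (size s) != 0%N.
  apply: (@rank_neq0_of_socle K n P _ F _ edge_idealP s 'X_[m]).
  - exact: bip_monomial_upclosed.
  - by rewrite map_inj_uniq ?enum_uniq //; apply: enum_rank_inj.
  - move=> _ /mapP[x + ->]; rewrite mem_enum inE => /domS[y Sy xy].
    rewrite -mpolyXD /monomial_ideal msuppX /= andbT; apply/bip_edgeP.
    by exists x, y; rewrite !mnmDE !mE !mnm1E eqxx Sy !addn_eq0 !negb_and /= orbT.
  rewrite /monomial_ideal msuppX /= andbT; apply/negP=> /bip_edgeP[x [y [xy]]].
  rewrite !mE => xS yS; have := indS x y; rewrite xy; move: xS yS.
  by case: (x \in S) (y \in S) => -[] // _ _ /(_ isT isT).
rewrite size_map -cardE; set h := #|_| => rk0.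
have r : 'I_(res_rank F h) by apply: (Ordinal (n := res_rank F h) (m := 0)); rewrite lt0n.
exists (res_deg r), #|[set r' : 'I_(res_rank F h) | res_deg r' == res_deg r]|.
  by exists F.
by rewrite -lt0n; apply/card_gt0P; exists r; rewrite inE.
Qed.

(** [betti_le] bounds the degrees by n, so minimising n - i selects the largest one. *)
Lemma is_pd_exists : (exists i j, betti_neq0 (@edge_ideal K G) i j) ->
  exists p, is_pd K G p.
Proof.
pose b i := exists j, betti_neq0 (@edge_ideal K G) i j.
move=> [i0 bi0]; have le_n i : b i -> (i <= n)%N.
  by case=> j /betti_le[X _]; apply: leq_trans; apply: leq_addr.
have [|d [i [Dd bi]] mind] := @classical_min (fun d => exists i, d = (n - i)%N /\ b i).
  by exists (n - i0)%N, i0.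
exists i; split=> // i' j bi'; rewrite leqNgt; apply/negP=> lt_ii'.
have bi'' : b i' by exists j.
apply: (mind (n - i')%N); last by exists i'.
by have := le_n _ bi''; lia.
Qed.

End GraphProjdim.

(** * Bipartite Kneser graphs *)

Section Kneser.
Variables m k : nat.
Hypotheses (k_gt0 : (0 < k)%N) (le_2k_m : (2 * k <= m)%N).
Local Notation G := (bipartite_kneser m k).

Definition left_side : {set G} := [set u | if u is inl _ then true else false].

Definition vset (u : G) : {set 'I_m} :=
  match u with inl A => val A | inr B => val B end.

Lemma kneser_adj_sides (x y : G) : adj x y -> (x \in left_side) != (y \in left_side).
Proof. by case: x y => [x|x] [y|y] //=; rewrite !inE. Qed.

Lemma exists_ksubset (l : nat) (T : {set 'I_m}) : (l <= #|T|)%N ->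
  exists2 S : {set 'I_m}, S \subset T & #|S| == l.
Proof.
move=> le_l; have /card_gt0P[S] : (0 < #|[set S : {set 'I_m} | S \subset T & #|S| == l]|)%N.
  by rewrite cards_draws bin_gt0.
by rewrite inE => /andP[]; exists S.
Qed.

Lemma card_ksubset l : #|{: ksubset m l}| = 'C(m, l).
Proof.
rewrite card_sig -[m in RHS]card_ord -card_draws.
by apply: eq_card => S; rewrite !inE.
Qed.

Lemma card_left_side : #|left_side| = 'C(m, k).
Proof.
rewrite -card_ksubset -(card_imset _ (@inl_inj (ksubset m k) (ksubset m (m - k)))).
apply: eq_card => -[A|B]; rewrite !inE; apply/esym.
  by apply/imsetP; exists A.
by apply/imsetP=> -[].
Qed.

Lemma card_kneser : #|G| = (2 * 'C(m, k))%N.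
Proof.
rewrite card_sum !card_ksubset bin_sub ?addnn ?mul2n //; lia.
Qed.

Lemma card_dominated (B : ksubset m (m - k)) :
  (#|[set x in left_side | adj x (inr B : G)]| <= 'C(m - k, k))%N.
Proof.
rewrite -[(m - k)%N in X in (_ <= X)%N](eqP (valP B)) -cards_draws.
rewrite -(card_in_imset (f := vset)); last first.
  by move=> [x|x] [y|y]; rewrite !inE //= => _ _ /val_inj->.
apply/subset_leq_card/subsetP=> _ /imsetP[[x|x] + ->]; rewrite !inE //= => ->.
exact: valP x.
Qed.

(** Every left vertex is undominated or among the at most C(m-k,k) neighbours of some vertex of
    [X]. *)
Lemma domination_ge_degree (X : {set G}) : X \subset ~: left_side ->
  ('C(m, k) <= (#|X| + #|undominated (@adj G) left_side X|) * 'C(m - k, k))%N.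
Proof.
move=> sX; rewrite -card_left_side; set U := undominated _ _ _.
have D_gt0 : (0 < 'C(m - k, k))%N by rewrite bin_gt0; lia.
have sub : left_side \subset U :|: \bigcup_(b in X) [set x in left_side | adj x b].
  apply/subsetP=> x Lx; rewrite in_setU; have [//|xU] := boolP (x \in U).
  move: xU; rewrite inE Lx /= negb_forall_in => /exists_inP[b Xb]; rewrite negbK => xb.
  by apply/bigcupP; exists b; rewrite // inE Lx.
apply: leq_trans (subset_leq_card sub) _; apply: leq_trans (leq_card_setU _ _) _.
rewrite mulnDl addnC leq_add //; last by rewrite leq_pmulr.
rewrite -sum_nat_const.
apply: (big_ind2 (fun (S : {set G}) c => #|S| <= c)%N) => [|S1 c1 S2 c2 le1 le2|b Xb].
- by rewrite cards0.
- by apply: leq_trans (leq_card_setU _ _) (leq_add le1 le2).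
case: b Xb => b Xb; last exact: card_dominated.
by have := subsetP sX _ Xb; rewrite !inE.
Qed.

(** Otherwise choose a point outside each set in [X :|: U] and extend these at most [k] points to a
    [k]-set [A]. No set of [X] contains [A], so [A] is undominated and belongs to [U]; but then [A]
    would miss one of its own points. *)
Lemma domination_gt (X : {set G}) : X \subset ~: left_side ->
  (k < #|X| + #|undominated (@adj G) left_side X|)%N.
Proof.
move=> sX; rewrite ltnNge; apply/negP=> le_k; set U := undominated _ _ _ in le_k.
have vsetT (u : G) : exists i, i \notin vset u.
  have /card_gt0P[i] : (0 < #|~: vset u|)%N.
    by rewrite cardsCs setCK card_ord; case: u => S /=; rewrite (eqP (valP S)); lia.
  by rewrite inE; exists i.
pose Q := [set xchoose (vsetT u) | u in X :|: U].
have le_Qk : (#|Q| <= k)%N.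
  apply: leq_trans (leq_imset_card _ _) _; apply: leq_trans (leq_card_setU _ _) le_k.
have [S sSQ cS] : exists2 S : {set 'I_m}, S \subset ~: Q & #|S| == (k - #|Q|)%N.
  by apply: exists_ksubset; have := cardsC Q; rewrite card_ord; lia.
have cA : #|Q :|: S| == k.
  rewrite cardsU (eqP cS) disjoint_setI0 ?cards0; first lia.
  by rewrite disjoint_sym disjoints_subset.
pose A : ksubset m k := Sub (Q :|: S) cA.
have nXU u : u \in X :|: U -> ~~ (Q :|: S \subset vset u).
  move=> XUu; apply/negP=> /subsetP/(_ (xchoose (vsetT u))).
  by rewrite inE imset_f // (negPf (xchooseP (vsetT u))) => /(_ isT).
have UA : (inl A : G) \in U.
  rewrite !inE /=; apply/forall_inP=> -[b|b] Xb //=.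
  by apply: (nXU (inr b)); rewrite inE Xb.
by have := nXU (inl A); rewrite inE UA orbT /= subxx => /(_ isT).
Qed.

(** * The maximal independent set behind the lower bound *)

Definition core_ground : {set 'I_m} := [set i : 'I_m | (i < 2 * k - 1)%N].

(* Both sides of a maximal cross-intersecting family: the k-subsets of a fixed
   (2k-1)-set, the right-hand ones being recorded by their complements. *)
Definition small_core : {set G} :=
  [set u : G | match u : kneser_vertex m k with
               | inl A => val A \subset core_ground
               | inr B => ~: val B \subset core_ground
               end].

Lemma card_core_ground : #|core_ground| = (2 * k - 1)%N.
Proof.
have le : (2 * k - 1 <= m)%N by lia.
have inj : injective (widen_ord le) by move=> i j [] /val_inj.
rewrite -[RHS]card_ord -(card_imset _ inj).
apply: eq_card => i; rewrite inE; apply/idP/imsetP => [lt_i|[j _ ->] /=].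
  by exists (Ordinal lt_i) => //; apply: val_inj.
exact: ltn_ord.
Qed.

Lemma card_ksetC (B : ksubset m (m - k)) : #|~: val B| = k.
Proof. by rewrite cardsCs setCK card_ord (eqP (valP B)); lia. Qed.

(** Pascal's rule and symmetry give C(2k,k) = 2 C(2k-1,k), and each side injects into the
    [k]-subsets of the ground set. *)
Lemma card_small_core : (#|small_core| <= 'C(2 * k, k))%N.
Proof.
have -> : 'C(2 * k, k) = ('C(2 * k - 1, k) + 'C(2 * k - 1, k))%N.
  have -> : (2 * k = (2 * k - 1).+1)%N by lia.
  case: k k_gt0 => // l _; rewrite binS; congr (_ + _)%N; first by congr 'C(_, _); lia.
  rewrite -bin_sub; last lia.
  by congr 'C(_, _); lia.
have cT := card_core_ground.
rewrite -(cardsID left_side); apply: leq_add; rewrite -cT -cards_draws.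
  rewrite -(card_in_imset (f := vset)); last first.
    by move=> [x|x] [y|y]; rewrite !inE ?andbF //= => _ _ /val_inj->.
  apply/subset_leq_card/subsetP=> _ /imsetP[[x|x] + ->]; rewrite !inE ?andbF //= andbT => ->.
  exact: valP x.
rewrite -(card_in_imset (f := fun u => ~: vset u)); last first.
  by move=> [x|x] [y|y]; rewrite !inE ?andbF //= => _ _ /setC_inj/val_inj->.
apply/subset_leq_card/subsetP=> _ /imsetP[[x|x] + ->]; rewrite !inE ?andbF //= => ->.
by rewrite card_ksetC eqxx.
Qed.

(** An edge from A to B would make A and the complement of B disjoint [k]-subsets of a
    (2k-1)-set. *)
Lemma small_core_indep : {in small_core &, forall x y, ~~ adj x y}.
Proof.
have indep (A : ksubset m k) (B : ksubset m (m - k)) :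
    (inl A : G) \in small_core -> (inr B : G) \in small_core -> ~~ (val A \subset val B).
  rewrite !inE => AT BT; apply/negP=> AB.
  have : (#|val A :|: ~: val B| <= 2 * k - 1)%N.
    by rewrite -card_core_ground; apply: subset_leq_card; rewrite subUset AT.
  rewrite cardsU card_ksetC (eqP (valP A)) disjoint_setI0 ?cards0; first lia.
  by rewrite disjoints_subset setCK.
by move=> [x|x] [y|y] // Sx Sy; apply: indep.
Qed.

(** A [k]-set not inside the ground set meets it in at most k - 1 points, leaving at least [k]
    points for a disjoint [k]-subset. For a right vertex this is applied to its complement. *)
Lemma small_core_dom (x : G) : x \notin small_core ->
  exists2 y, y \in small_core & adj x y.
Proof.
set T := core_ground; have cT : #|T| = (2 * k - 1)%N := card_core_ground.
have ex (S : {set 'I_m}) : #|S| = k -> ~~ (S \subset T) ->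
    exists2 S' : {set 'I_m}, S' \subset T :\: S & #|S'| == k.
  move=> cS ST; apply: exists_ksubset.
  have : (#|S :&: T| < k)%N.
    rewrite -cS; apply: proper_card; rewrite properE subsetIl /=.
    by rewrite subsetI subxx.
  by have := cardsID S T; rewrite cT setIC; lia.
case: x => [A|B]; rewrite inE => nT.
  have [S + cS] := ex _ (eqP (valP A)) nT; rewrite subsetD => /andP[ST SA].
  have cB : #|~: S| == (m - k)%N by rewrite cardsCs setCK card_ord (eqP cS).
  exists (inr (Sub (~: S) cB)); first by rewrite inE /= setCK.
  by rewrite /= -disjoints_subset disjoint_sym.
have [S + cS] := ex _ (card_ksetC B) nT; rewrite subsetD => /andP[ST SB].
exists (inl (Sub S cS)); first by rewrite inE.
by rewrite /=; move: SB; rewrite disjoints_subset setCK.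
Qed.

End Kneser.

Theorem theorem1p4 (K : fieldType) (K_infinite : infinite K) (m k : nat)
    (k_gt0 : (0 < k)%N) (le_2k_m : (2 * k <= m)%N) :
  exists2 p : nat, is_pd K (bipartite_kneser m k) p &
    2 * 'C(m, k)%:R - 'C(2 * k, k)%:R <= p%:R :> rat /\
    p%:R <= 2 * 'C(m, k)%:R
            - Num.max k.+1%:R ('C(m, k)%:R / 'C(m - k, k)%:R) :> rat.
Proof.
have sides := @kneser_adj_sides m k.
have [j bj] := @betti_neq0_codim K _ _ _ erefl sides _
  (small_core_indep k_gt0 le_2k_m) (small_core_dom k_gt0 le_2k_m).
have [|p pdp] := @is_pd_exists K _ _ _ erefl sides; first by eexists; exists j; exact: bj.
exists p => //; case: pdp => [[i bi] maxp]; split.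
  (* The complement of the core has at least 2 C(m,k) - C(2k,k) vertices. *)
  have := maxp _ _ bj; have := cardsC (small_core m k); rewrite card_kneser //.
  have := card_small_core k_gt0 le_2k_m; move=> cS cG le_p.
  rewrite lerBlDr -natrM -natrD ler_nat; lia.
(* At [i = p] this yields a set [X] of cost [x] with p + x <= 2 C(m,k); both terms of the maximum
   are bounded by [x]. *)
have [X sX le_n] := betti_le erefl sides bi.
rewrite card_kneser // in le_n; set x := (#|X| + _)%N in le_n.
have D_gt0 : (0 < 'C(m - k, k))%N by rewrite bin_gt0; lia.
rewrite lerBrDr -lerBrDl; apply: (@le_trans _ _ x%:R).
  rewrite ge_max ler_nat domination_gt //= ler_pdivrMr ?ltr0n // -natrM ler_nat.
  exact: domination_ge_degree.
by rewrite lerBrDl -natrM -natrD ler_nat.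
Qed.
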